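(* Let $\mathbf A$ be a finite idempotent minimal Taylor algebra, let $(a,b)$ be an edge of $\mathbf A$, let $\mathbf E=\mathrm{Sg}_{\mathbf A}(a,b)$, and let $\theta$ be a congruence of $\mathbf E$ witnessing the edge. (a) If $(a,b)$ is a semilattice edge (witnessed by $\theta$), then $\mathbf E/\theta$ is term-equivalent to a two-element semilattice whose absorbing element is $b/\theta$. (b) If $(a,b)$ is a majority edge (witnessed by $\theta$), then $\mathbf E/\theta$ is term-equivalent to the two-element majority algebra. (c) If $(a,b)$ is an abelian edge (witnessed by $\theta$), then $\mathbf E/\theta$ is term-equivalent to the affine Mal'cev algebra of an abelian group isomorphic to $\mathbb Z_{p_1^{k_1}}\times\dots\times\mathbb Z_{p_i^{k_i}}$ for some distinct primes $p_1,\dots,p_i$ and positive integers $k_1,\dots,k_i$. Moreover, a semilattice edge is witnessed by exactly one congruence of $\mathbf E$, and that congruence is maximal; the same holds for majority edges.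
   Context: For $a,b\in A$, $\mathbf E=\mathrm{Sg}_{\mathbf A}(a,b)$ is the subalgebra generated by $a,b$. $(a,b)$ is an edge witnessed by a proper congruence $\theta$ of $\mathbf E$ if: (semilattice) some binary term operation acts on $\{a/\theta,b/\theta\}$ as a join-semilattice operation with top $b/\theta$; or (majority) some ternary term operation acts on $\{a/\theta,b/\theta\}$ as a majority operation; or (abelian) $\mathbf E/\theta$ is abelian, i.e., the diagonal is a block of some congruence of $(\mathbf E/\theta)^2$. The two-element semilattice is $(\{0,1\};\vee)$; the two-element majority algebra is $(\{0,1\};\mathrm{maj})$; the affine Mal'cev algebra of an abelian group $G$ is $(G; x-y+z)$; $\mathbb Z_m$ is the integers modulo $m$. Term-equivalent means having the same term operations. $\mathbf A$ is minimal Taylor if it is Taylor (no quotient of a subalgebra of a finite power is a two-element algebra of projections) and no reduct with strictly smaller clone is Taylor. *)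

(* Defs.v *)
From HB Require Import structures.
From mathcomp Require Import all_boot all_algebra.
From mathcomp Require Import boolp.

Set Implicit Arguments.
Unset Strict Implicit.
Unset Printing Implicit Defensive.

Import GRing.Theory.
Local Open Scope ring_scope.
Local Open Scope quotient_scope.

(** * Algebras, terms and clones *)

Record signature := Signature { sym : Type; arity : sym -> nat }.

Definition oper (T : Type) (n : nat) := n.-tuple T -> T.

Definition algebra (S : signature) (T : Type) :=
  forall f : sym S, oper T (arity f).

Inductive term (S : signature) (V : Type) : Type :=
  | Var of V
  | App (f : sym S) of ('I_(arity f) -> term S V).

Fixpoint eval (S : signature) (T : Type) (A : algebra S T) (V : Type)
    (e : V -> T) (t : term S V) : T :=
  match t with
  | Var v => e v
  | App f ts => A f [tuple eval A e (ts i) | i < arity f]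
  end.

Definition term_op (S : signature) (T : Type) (A : algebra S T) (n : nat)
    (g : oper T n) : Prop :=
  exists t : term S 'I_n, forall x : n.-tuple T, g x = eval A (tnth x) t.

(* Clo(A) is contained in Clo(B); the signatures may differ. *)
Definition clone_sub (S S' : signature) (T : Type)
    (A : algebra S T) (B : algebra S' T) : Prop :=
  forall n (g : oper T n), term_op A g -> term_op B g.

Definition reduct (S S' : signature) (T : Type)
    (B : algebra S' T) (A : algebra S T) : Prop :=
  forall f : sym S', term_op A (B f).

(* A and B have the same term operations, once their universes are identified
   along the bijection phi. *)
Definition term_equivalent_via (S S' : signature) (T T' : Type)
    (A : algebra S T) (B : algebra S' T') (phi : T -> T') : Prop :=
  bijective phi /\
  forall n (g : oper T n) (g' : oper T' n),
    (forall x : n.-tuple T, phi (g x) = g' [tuple of map phi x]) ->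
    (term_op A g <-> term_op B g').

Definition term_equivalent (S S' : signature) (T T' : Type)
    (A : algebra S T) (B : algebra S' T') : Prop :=
  exists phi : T -> T', term_equivalent_via A B phi.

Definition idempotent_algebra (S : signature) (T : Type) (A : algebra S T) :=
  forall (f : sym S) (x : T), A f [tuple x | _ < arity f] = x.

(** * Powers, subalgebras, congruences and quotients *)

Definition power (S : signature) (T : Type) (A : algebra S T) (k : nat) :
    algebra S (k.-tuple T) :=
  fun f xs => [tuple A f [tuple tnth (tnth xs i) j | i < arity f] | j < k].

Arguments power {S T} A k _ _.

Definition subuniverse (S : signature) (T : finType) (A : algebra S T)
    (X : {set T}) : Prop :=
  forall (f : sym S) (x : (arity f).-tuple T),
    (forall i, tnth x i \in X) -> A f x \in X.

Lemma subalg_subproof (S : signature) (T : finType) (A : algebra S T)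
    (X : {set T}) (hX : subuniverse A X) (f : sym S)
    (x : (arity f).-tuple {x : T | x \in X}) :
  A f [tuple of map val x] \in X.
Proof. by apply: hX => i; rewrite tnth_map; exact: valP. Qed.

Definition subalg (S : signature) (T : finType) (A : algebra S T)
    (X : {set T}) (hX : subuniverse A X) : algebra S {x : T | x \in X} :=
  fun f x => exist _ (A f [tuple of map val x]) (subalg_subproof hX x).

Arguments subalg {S T A X} hX _ _.

Record congruence (S : signature) (T : Type) (A : algebra S T) := Congruence {
  con_rel :> equiv_rel T;
  con_compat : forall (f : sym S) (x y : (arity f).-tuple T),
    (forall i, con_rel (tnth x i) (tnth y i)) -> con_rel (A f x) (A f y) }.

Definition quotient_carrier (S : signature) (T : choiceType)
    (A : algebra S T) (theta : congruence A) : choiceType :=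
  {eq_quot (con_rel theta)}.

Definition block (S : signature) (T : choiceType) (A : algebra S T)
    (theta : congruence A) (x : T) : quotient_carrier theta :=
  \pi_({eq_quot (con_rel theta)}) x.

(* The basic operations are computed on representatives; by compatibility the
   choice is immaterial (quotient_alg_block). *)
Definition quotient_alg (S : signature) (T : choiceType) (A : algebra S T)
    (theta : congruence A) : algebra S (quotient_carrier theta) :=
  fun f x =>
    block theta (A f [tuple repr (tnth x i : {eq_quot (con_rel theta)})
                     | i < arity f]).

Arguments quotient_alg {S T A} theta _ _.

Lemma block_eq (S : signature) (T : choiceType) (A : algebra S T)
    (theta : congruence A) (x y : T) :
  (block theta x == block theta y) = theta x y.
Proof. by rewrite /block eqmodE. Qed.

Lemma quotient_alg_block (S : signature) (T : choiceType) (A : algebra S T)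
    (theta : congruence A) (f : sym S) (x : (arity f).-tuple T) :
  quotient_alg theta f [tuple of map (block theta) x]
    = block theta (A f x).
Proof.
apply/eqP; rewrite block_eq; apply: con_compat => i.
by rewrite tnth_mktuple tnth_map -block_eq /block reprK.
Qed.

Definition proper (S : signature) (T : Type) (A : algebra S T)
    (theta : congruence A) : Prop :=
  ~ (forall x y : T, theta x y).

Definition maximal_congruence (S : signature) (T : Type) (A : algebra S T)
    (theta : congruence A) : Prop :=
  proper theta /\
  forall psi : congruence A, proper psi ->
    (forall x y, theta x y -> psi x y) -> psi =2 theta.

(** * Taylor algebras *)

Definition is_projection (T : Type) (n : nat) (g : oper T n) : Prop :=
  exists i : 'I_n, forall x : n.-tuple T, g x = tnth x i.

Definition two_element_projections (S : signature) (T : Type)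
    (A : algebra S T) : Prop :=
  (exists phi : T -> bool, bijective phi) /\
  forall f : sym S, is_projection (A f).

Definition Taylor (S : signature) (T : finType) (A : algebra S T) : Prop :=
  forall (k : nat) (X : {set k.-tuple T}) (hX : subuniverse (power A k) X)
    (theta : congruence (subalg hX)),
    ~ two_element_projections (quotient_alg theta).

Definition minimal_Taylor (S : signature) (T : finType) (A : algebra S T) :=
  Taylor A /\
  forall (S' : signature) (B : algebra S' T),
    reduct B A -> ~ clone_sub A B -> ~ Taylor B.

(** * Edges *)

Definition Sg (S : signature) (T : finType) (A : algebra S T) (a b : T) :
    {set T} :=
  \bigcap_(X : {set T} | `[< subuniverse A X /\ a \in X /\ b \in X >]) X.

Lemma Sg_subuniverse (S : signature) (T : finType) (A : algebra S T)
    (a b : T) : subuniverse A (Sg A a b).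
Proof.
move=> f x hx; apply/bigcapP => X hX; have [hs _] := asboolP _ hX.
by apply: hs => i; move/bigcapP: (hx i); exact.
Qed.

Lemma Sg_left (S : signature) (T : finType) (A : algebra S T) (a b : T) :
  a \in Sg A a b.
Proof. by apply/bigcapP => X /asboolP [_ []]. Qed.

Lemma Sg_right (S : signature) (T : finType) (A : algebra S T) (a b : T) :
  b \in Sg A a b.
Proof. by apply/bigcapP => X /asboolP [_ []]. Qed.

Definition Sg_carrier (S : signature) (T : finType) (A : algebra S T)
    (a b : T) : finType := {x : T | x \in Sg A a b}.

Definition Sg_alg (S : signature) (T : finType) (A : algebra S T) (a b : T) :
    algebra S (Sg_carrier A a b) :=
  subalg (@Sg_subuniverse S T A a b).

Arguments Sg_alg {S T} A a b _ _.

Definition gen_left (S : signature) (T : finType) (A : algebra S T)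
    (a b : T) : Sg_carrier A a b := exist _ a (Sg_left A a b).

Definition gen_right (S : signature) (T : finType) (A : algebra S T)
    (a b : T) : Sg_carrier A a b := exist _ b (Sg_right A a b).

Definition acts_as_join_semilattice (T : Type) (g : oper T 2) (P : T -> Prop)
    (top : T) : Prop :=
  let j x y := g [tuple x; y] in
  [/\ forall x y, P x -> P y -> P (j x y),
      forall x, P x -> j x x = x,
      forall x y, P x -> P y -> j x y = j y x,
      forall x y z, P x -> P y -> P z -> j x (j y z) = j (j x y) z
    & P top /\ forall x, P x -> j x top = top].

Definition acts_as_majority (T : Type) (g : oper T 3) (P : T -> Prop) : Prop :=
  forall x y, P x -> P y ->
    [/\ g [tuple x; x; y] = x, g [tuple x; y; x] = x & g [tuple y; x; x] = x].

(* The diagonal is a block (that of z) of a congruence of the square. *)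
Definition abelian_algebra (S : signature) (T : Type) (A : algebra S T) :=
  exists (beta : congruence (power A 2)) (z : 2.-tuple T),
    forall x : 2.-tuple T, beta z x <-> tnth x 0 = tnth x 1.

Definition in_generator_blocks (S : signature) (T : finType) (A : algebra S T)
    (a b : T) (theta : congruence (Sg_alg A a b))
    (x : quotient_carrier theta) : Prop :=
  x = block theta (gen_left A a b) \/ x = block theta (gen_right A a b).

Definition semilattice_witness (S : signature) (T : finType)
    (A : algebra S T) (a b : T) (theta : congruence (Sg_alg A a b)) : Prop :=
  proper theta /\
  exists2 g : oper (quotient_carrier theta) 2,
    term_op (quotient_alg theta) g &
    acts_as_join_semilattice g (@in_generator_blocks S T A a b theta)
      (block theta (gen_right A a b)).

Definition majority_witness (S : signature) (T : finType)
    (A : algebra S T) (a b : T) (theta : congruence (Sg_alg A a b)) : Prop :=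
  proper theta /\
  exists2 g : oper (quotient_carrier theta) 3,
    term_op (quotient_alg theta) g &
    acts_as_majority g (@in_generator_blocks S T A a b theta).

Definition abelian_witness (S : signature) (T : finType)
    (A : algebra S T) (a b : T) (theta : congruence (Sg_alg A a b)) : Prop :=
  proper theta /\ abelian_algebra (quotient_alg theta).

Definition edge_witness (S : signature) (T : finType)
    (A : algebra S T) (a b : T) (theta : congruence (Sg_alg A a b)) : Prop :=
  [\/ semilattice_witness theta, majority_witness theta
    | abelian_witness theta].

(** * The target algebras *)

Definition one_symbol (n : nat) : signature := @Signature unit (fun _ => n).

Definition semilattice2 : algebra (one_symbol 2) bool :=
  fun _ x => tnth x 0 || tnth x 1.

Definition majority2 : algebra (one_symbol 3) bool :=
  fun _ x => [|| tnth x 0 && tnth x 1, tnth x 0 && tnth x 2%:R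
               | tnth x 1 && tnth x 2%:R].

Definition affine_malcev (G : zmodType) : algebra (one_symbol 3) G :=
  fun _ x => tnth x 0 - tnth x 1 + tnth x 2%:R.

Arguments semilattice2 : clear implicits.
Arguments majority2 : clear implicits.
Arguments affine_malcev : clear implicits.

(* G is isomorphic to the product of the Z_(m j), j < r. As 'Z_n is Z modulo n
   only for n > 1, this is meant for m j > 1. *)
Definition isomorphic_to_prod_Z (G : zmodType) (r : nat) (m : 'I_r -> nat) :=
  exists h : G -> {dffun forall j : 'I_r, 'Z_(m j)},
    bijective h /\ forall x y j, h (x + y) j = h x j + h y j.

(* Main.v *)
(* The engine is a source of Taylor reducts that avoids cyclic terms: in a finite
   idempotent Taylor algebra, any nonempty set of N-ary terms (N >= |A| + 2) that
   is closed under permuting variables and under the operations of A generates a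
   Taylor reduct.  If A is minimal Taylor, such a set generates the whole clone.
   Take for it all terms acting on a quotient E/theta as one fixed symmetric
   operation: the N-ary join, the N-ary majority, or x_1 + ... + x_N with
   N = 1 modulo |E/theta|.  Every term operation of E/theta is
   then a composition of that operation, so it lies in the target clone and
   preserves {a/theta, b/theta} in the first two cases.  Uniqueness of the
   congruence comes from the same argument applied to E/theta x E/theta', after
   the two witnessing terms are merged into one that works modulo both.

   In the abelian case one first needs a Malcev term.  Taylor excludes that each
   term t has a variable i with t(X, .., W at i, .., X) inside W, for a fixed proper
   subset W of X, because by the term condition that variable would be unique and
   define a homomorphism to projections.  So there are terms that are onto even
   after any one variable is fixed, and with the term condition these make
   every compatible relation rectangular.  The resulting group is generated by
   b/theta when a/theta is the zero, hence cyclic. *)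

From HB Require Import structures.
From mathcomp Require Import all_boot perm all_algebra.
From mathcomp Require Import boolp zify.
Require Import Defs.

Set Implicit Arguments.
Unset Strict Implicit.
Unset Printing Implicit Defensive.

Import GRing.Theory.

(** * Minion homomorphisms and the Taylor property *)

Fixpoint subst (S : signature) (V W : Type) (g : V -> term S W)
    (t : term S V) : term S W :=
  match t with
  | Var v => g v
  | App f ts => App (fun i => subst g (ts i))
  end.

Definition rename (S : signature) (V W : Type) (s : V -> W) :=
  subst (fun v => Var S (s v)).

Lemma eval_ext (S : signature) (T : Type) (A : algebra S T) (V : Type)
    (e e' : V -> T) (t : term S V) : e =1 e' -> eval A e t = eval A e' t.
Proof. by move=> /funext ->. Qed.

Lemma eval_subst (S : signature) (T : Type) (A : algebra S T) (V W : Type)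
    (e : W -> T) (g : V -> term S W) (t : term S V) :
  eval A e (subst g t) = eval A (fun v => eval A e (g v)) t.
Proof.
elim: t => //= f ts IH; congr (A f _).
by apply: eq_from_tnth => i; rewrite !tnth_mktuple.
Qed.

Lemma eval_rename (S : signature) (T : Type) (A : algebra S T) (V W : Type)
    (e : W -> T) (s : V -> W) (t : term S V) :
  eval A e (rename s t) = eval A (e \o s) t.
Proof. exact: eval_subst. Qed.

Lemma eval_idem (S : signature) (T : Type) (A : algebra S T) (V : Type)
    (x : T) (t : term S V) :
  idempotent_algebra A -> eval A (fun=> x) t = x.
Proof.
move=> idA; elim: t => //= f ts IH; rewrite -[RHS](idA f); congr (A f _).
by apply: eq_from_tnth => i; rewrite !tnth_mktuple.
Qed.

Lemma eval_closed (S : signature) (T : Type) (A : algebra S T) (P : T -> Prop)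
    (V : Type) (e : V -> T) (t : term S V) :
  (forall f (x : (arity f).-tuple T), (forall i, P (tnth x i)) -> P (A f x)) ->
  (forall v, P (e v)) -> P (eval A e t).
Proof.
move=> cP Pe; elim: t => //= f ts IH; apply: cP => i.
by rewrite tnth_mktuple.
Qed.

Lemma eval_hom (S : signature) (T T' : Type) (A : algebra S T)
    (A' : algebra S T') (h : T -> T') (V : Type) (e : V -> T) (t : term S V) :
  (forall f x, h (A f x) = A' f [tuple of map h x]) ->
  h (eval A e t) = eval A' (h \o e) t.
Proof.
move=> hh; elim: t => //= f ts IH; rewrite hh; congr (A' f _).
by apply: eq_from_tnth => i; rewrite tnth_map !tnth_mktuple.
Qed.

Definition same_op (S : signature) (T : Type) (A : algebra S T) (V : Type)
    (s t : term S V) : Prop := forall e, eval A e s = eval A e t.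

(** By Birkhoff's theorem this says that [B] lies in the variety generated by [A]; it passes to
    subalgebras, quotients, products and powers alike. *)
Record models (S : signature) (T T' : Type) (A : algebra S T)
    (B : algebra S T') : Prop := Models {
  models_same_op : forall (V : finType) (s t : term S V),
    same_op A s t -> same_op B s t }.

(* A minion homomorphism from the clone of A to the projections. *)
Definition coordinate_choice (S : signature) (T : Type) (A : algebra S T)
    (xi : forall V : finType, term S V -> V) : Prop :=
  (forall (V : finType) (s t : term S V), same_op A s t -> xi V s = xi V t) /\
  (forall (V W : finType) (h : V -> W) (t : term S V),
     xi W (rename h t) = h (xi V t)).

(* Idempotence makes a minion homomorphism compatible with composition: in the
   term t(g_v) on the variables (v, w), only the block v = xi t counts, so every
   other g_v may be replaced by g_(xi t). *)
Lemma coordinate_choice_subst (S : signature) (T : Type) (A : algebra S T) xi :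
  idempotent_algebra A -> coordinate_choice A xi ->
  forall (V W : finType) (g : V -> term S W) (t : term S V),
    xi W (subst g t) = xi W (g (xi V t)).
Proof.
move=> idA [xiE xiR] V W g t; set i := xi V t.
pose star (g : V -> term S W) := subst (fun v => rename (pair v) (g v)) t.
have starE k : xi _ (star k) = (i, xi W (subst k t)).
  rewrite [LHS]surjective_pairing -(xiR _ _ fst) -(xiR _ _ snd).
  congr (_, _); apply: xiE => e.
    rewrite eval_rename eval_subst; apply: eval_ext => v.
    by rewrite eval_rename -[RHS](eval_idem _ (k v) idA).
  rewrite eval_rename !eval_subst; apply: eval_ext => v.
  by rewrite eval_rename.
(* Collapse every block but [i] to the single variable [None]: by idempotence this erases each [k v]
   with [v] distinct from [i], so only [k i] is left. *)
pose tau (p : V * W) := if p.1 == i then Some p.2 else None.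
pose t' (s : term S W) :=
  subst (fun v => if v == i then rename Some s else Var S None) t.
have tauE k : Some (xi W (subst k t)) = xi _ (t' (k i)).
  transitivity (xi _ (rename tau (star k))).
    by rewrite xiR starE /tau eqxx.
  apply: xiE => e; rewrite eval_rename !eval_subst; apply: eval_ext => v.
  rewrite eval_rename /tau /=; case: eqP => [->|ne].
    by rewrite eval_rename; apply: eval_ext => w /=; rewrite eqxx.
  rewrite -[RHS](eval_idem _ (k v) idA); apply: eval_ext => w /=.
  by case: eqP.
have := tauE g; rewrite -(tauE (fun=> g i)) => -[->].
by apply: xiE => e; rewrite eval_subst eval_idem.
Qed.

(** A quotient of [X] onto a two-element algebra of projections, kept as the indicator [c] of one
    class to avoid quotient types; only the values of [c] on [X] matter. *)
Definition two_class_projective (S : signature) (T : finType)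
    (A : algebra S T) (X : {set T}) (c : T -> bool) : Prop :=
  [/\ subuniverse A X, exists2 x, x \in X & c x, exists2 x, x \in X & ~~ c x
    & forall f, exists i : 'I_(arity f), forall xs : (arity f).-tuple T,
        (forall j, tnth xs j \in X) -> c (A f xs) = c (tnth xs i)].

Lemma two_class_projective_not_Taylor (S : signature) (T : finType)
    (A : algebra S T) k X c :
  two_class_projective (power A k) X c -> ~ Taylor A.
Proof.
case=> hX [x1 x1X cx1] [x0 x0X cx0] hp tA.
pose r : rel {x | x \in X} := fun x y => c (val x) == c (val y).
have rE : equiv_class_of r.
  split=> [x|x y|y x z]; first exact: eqxx.
    exact: eq_sym.
  by rewrite /r => /eqP -> /eqP ->.
pose e := EquivRelPack rE.
have eC (f : sym S) (x y : (arity f).-tuple {x : k.-tuple T | x \in X}) :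
    (forall i, e (tnth x i) (tnth y i)) ->
    e (subalg hX f x) (subalg hX f y).
  move=> exy; apply/eqP => /=; have [i hi] := hp f.
  rewrite !hi ?tnth_map; first exact/eqP/exy.
    by move=> j; rewrite tnth_map; apply: valP.
  by move=> j; rewrite tnth_map; apply: valP.
pose theta := Congruence eC.
pose y (b : bool) : {x | x \in X} := if b then exist _ x1 x1X else exist _ x0 x0X.
have yE b : c (val (y b)) = b by case: b; rewrite //=; apply/negbTE.
apply: (tA k X hX theta); split.
  exists (fun q : quotient_carrier theta =>
            c (val (repr (q : {eq_quot (con_rel theta)}%qT)))).
  exists (block theta \o y).
    move=> q; rewrite -[RHS]reprK; apply/eqP; rewrite [_ == _]block_eq.
    by rewrite /= /r yE.
  move=> b /=; have : theta (repr (block theta (y b) : {eq_quot (con_rel theta)}%qT)) (y b).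
    by rewrite -block_eq /block reprK.
  by rewrite /= /r yE => /eqP.
move=> f; have [i hi] := hp f; exists i => x.
rewrite -[RHS]reprK /quotient_alg; apply/eqP; rewrite -/(block _ _) block_eq.
rewrite /= /r /= hi ?tnth_map ?tnth_ord_tuple //.
by move=> j; rewrite tnth_map; apply: valP.
Qed.

Lemma not_Taylor_two_class_projective (S : signature) (T : finType)
    (A : algebra S T) :
  ~ Taylor A -> exists k X c, two_class_projective (power A k) X c.
Proof.
move=> /existsNP[k /existsNP[X /existsNP[hX /existsNP[theta /contrapT]]]].
move=> [[phi [psi phiK psiK]] hp].
pose c (x : k.-tuple T) :=
  if insub x is Some y then phi (block theta y) else false.
have cE (y : {x | x \in X}) : c (val y) = phi (block theta y).
  by rewrite /c valK.
exists k, X, c; split => //.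
- pose y := repr (psi true : {eq_quot (con_rel theta)}%qT).
  exists (val y); first exact: valP.
  by rewrite cE /y /block reprK psiK.
- pose y := repr (psi false : {eq_quot (con_rel theta)}%qT).
  exists (val y); first exact: valP.
  by rewrite cE /y /block reprK psiK.
move=> f; have [i hi] := hp f; exists i => xs xsX.
pose ys := [tuple exist (fun x => x \in X) _ (xsX j) | j < arity f].
have -> : xs = [tuple of map val ys].
  by apply: eq_from_tnth => j; rewrite tnth_map tnth_mktuple.
rewrite tnth_map cE -[power _ _ _ _]/(val (subalg hX f ys)) cE.
by rewrite -quotient_alg_block hi tnth_map.
Qed.

(** Induction on the exponent. If the tuples of [X] with some fixed first entry meet both classes,
    idempotence makes their tails a subuniverse of a smaller power. Otherwise the first entry
    decides the class, and the first projection of [X] works in [A]. *)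
Lemma two_class_projective_power (S : signature) (T : finType)
    (A : algebra S T) k X c :
  idempotent_algebra A -> two_class_projective (power A k) X c ->
  exists X' c', two_class_projective A X' c'.
Proof.
move=> idA; elim: k X c => [|k IH] X c [hX [x1 x1X cx1] [x0 x0X cx0] hp].
  by move: cx1 cx0; rewrite (tuple0 x1) (tuple0 x0) => ->.
have [[h [y1 [y0 [y1X cy1 y0X cy0]]]]|nfib] := pselect (exists h (y1 y0 : k.-tuple T),
  [/\ [tuple of h :: y1] \in X, c [tuple of h :: y1],
      [tuple of h :: y0] \in X & ~~ c [tuple of h :: y0]]).
  pose cons_ (y : k.-tuple T) := [tuple of h :: y].
  have consE f (ys : (arity f).-tuple (k.-tuple T)) :
      cons_ (power A k f ys) = power A k.+1 f [tuple of map cons_ ys].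
    apply: eq_from_tnth => j; rewrite tnth_mktuple.
    case: (unliftP ord0 j) => [j' ->|->].
      rewrite tnthS tnth_mktuple; congr (A f _); apply: eq_from_tnth => i.
      by rewrite !tnth_mktuple tnth_map tnthS.
    rewrite tnth0 -[LHS](idA f); congr (A f _); apply: eq_from_tnth => i.
    by rewrite !tnth_mktuple tnth_map tnth0.
  apply: (IH [set y | cons_ y \in X] (c \o cons_)); split.
  - move=> f ys hys; rewrite inE consE; apply: hX => i.
    by rewrite tnth_map; have := hys i; rewrite inE.
  - by exists y1; rewrite ?inE.
  - by exists y0; rewrite ?inE.
  move=> f; have [i hi] := hp f; exists i => ys hys /=.
  rewrite consE hi ?tnth_map // => j.
  by rewrite tnth_map; have := hys j; rewrite inE.
pose X' := [set thead x | x in X].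
have cE x y : x \in X -> y \in X -> thead x = thead y -> c x = c y.
  rewrite (tuple_eta x) (tuple_eta y) => xX yX; rewrite !theadE => hxy.
  rewrite hxy in xX *.
  case cx : (c _); case cy : (c _) => //; case: nfib.
    by exists (thead y), [tuple of behead x], [tuple of behead y]; split; rewrite ?cx ?cy.
  by exists (thead y), [tuple of behead y], [tuple of behead x]; split; rewrite ?cx ?cy.
pose c' h := [exists x in X, (thead x == h) && c x].
have c'E x : x \in X -> c' (thead x) = c x.
  move=> xX; apply/existsP/idP => [[y /and3P[yX /eqP hy cy]]|cx].
    by rewrite -(cE y).
  by exists x; rewrite xX eqxx.
have headE f (xs : (arity f).-tuple (k.+1.-tuple T)) :
    thead (power A k.+1 f xs) = A f [tuple of map (@thead _ _) xs].
  rewrite /thead tnth_mktuple; congr (A f _); apply: eq_from_tnth => i.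
  by rewrite tnth_mktuple tnth_map.
have lift_ f (hs : (arity f).-tuple T) : (forall i, tnth hs i \in X') ->
    exists2 xs : (arity f).-tuple (k.+1.-tuple T),
      (forall i, tnth xs i \in X) & hs = [tuple of map (@thead _ _) xs].
  move=> hsX; have hs' i : exists2 x, x \in X & tnth hs i = thead x.
    exact/imsetP.
  exists [tuple s2val (cid2 (hs' i)) | i < arity f].
    by move=> i; rewrite tnth_mktuple; case: cid2.
  apply: eq_from_tnth => i; rewrite tnth_map tnth_mktuple.
  by case: cid2.
exists X', c'; split.
- move=> f hs /lift_[xs xsX ->]; rewrite -headE; apply: imset_f.
  exact: hX.
- by exists (thead x1); rewrite ?c'E // imset_f.
- by exists (thead x0); rewrite ?c'E // imset_f.
move=> f; have [i hi] := hp f; exists i => hs /lift_[xs xsX ->].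
by rewrite -headE c'E ?hi ?tnth_map ?c'E //; apply: hX.
Qed.

(** The binary terms, tabulated over all pairs of arguments, form the free algebra on two generators
    inside a power of [A]. There [xi] separates the generators, and by [coordinate_choice_subst]
    each basic operation acts on the classes of [xi] as a projection. *)
Lemma Taylor_coordinate_choice (S : signature) (T : finType)
    (A : algebra S T) xi :
  idempotent_algebra A -> Taylor A -> ~ coordinate_choice A xi.
Proof.
move=> idA tA cxi; have [xiE xiR] := cxi.
pose k := #|{: T * T}|.
pose env (j : 'I_k) (b : bool) : T :=
  if b then (enum_val j).1 else (enum_val j).2.
pose table (g : term S bool) : k.-tuple T :=
  [tuple eval A (env j) g | j < k].
have table_inj g g' : table g = table g' -> same_op A g g'.
  move=> eq_gg' e; have := congr1 (fun x => tnth x (enum_rank (e true, e false))) eq_gg'.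
  rewrite !tnth_mktuple => eqv.
  have envE : e =1 env (enum_rank (e true, e false)).
    by move=> b; rewrite /env enum_rankK; case: b.
  by rewrite !(eval_ext A _ envE).
pose X := [set x | `[< exists g, x = table g >]].
have XP x : x \in X -> exists g, x = table g by rewrite inE => /asboolP.
pose c x := if pselect (exists g, x = table g) is left h
            then xi _ (projT1 (cid h)) else false.
have cE g : c (table g) = xi _ g.
  rewrite /c; case: pselect => [h|[]]; last by exists g.
  by case: cid => g' /= /esym/table_inj/xiE.
have powE f (gs : 'I_(arity f) -> term S bool) :
    power A k f [tuple table (gs i) | i < arity f] = table (App gs).
  apply: eq_from_tnth => j; rewrite !tnth_mktuple /=; congr (A f _).
  by apply: eq_from_tnth => i; rewrite !tnth_mktuple.
have lift_ f (xs : (arity f).-tuple (k.-tuple T)) :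
    (forall i, tnth xs i \in X) ->
    exists gs, xs = [tuple table (gs i) | i < arity f].
  move=> xsX; exists (fun i => projT1 (cid (XP _ (xsX i)))).
  apply: eq_from_tnth => i; rewrite tnth_mktuple.
  by case: cid.
apply: (@two_class_projective_not_Taylor _ _ A k X c) tA; split.
- move=> f xs /lift_[gs ->]; rewrite powE inE; apply/asboolP.
  by exists (App gs).
- exists (table (Var S true)).
    by rewrite inE; apply/asboolP; exists (Var S true).
  by rewrite cE; apply: (xiR _ _ (fun=> true) (Var S true)).
- exists (table (Var S false)).
    by rewrite inE; apply/asboolP; exists (Var S false).
  by rewrite cE; apply/negbT/(xiR _ _ (fun=> false) (Var S false)).
move=> f; exists (xi _ (App (@Var S 'I_(arity f)))) => xs /lift_[gs ->].
rewrite powE !cE tnth_mktuple cE.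
exact: (coordinate_choice_subst idA cxi gs (App (@Var S 'I_(arity f)))).
Qed.

(** * Taylor reducts generated by symmetric ideals of terms *)

(** A member of least size is a singleton: splitting off one of its points leaves a smaller set,
    which cannot lie in [U]. *)
Lemma principal_ultrafilter (V : finType) (U : {set V} -> bool) :
  ~~ U set0 -> U setT ->
  (forall P Q : {set V}, [disjoint P & Q] -> U (P :|: Q) = U P || U Q) ->
  (forall P Q : {set V}, [disjoint P & Q] -> ~~ (U P && U Q)) ->
  exists v, forall P : {set V}, U P = (v \in P).
Proof.
move=> U0 UT UU UD.
case: (@arg_minnP _ setT U (fun P => #|P|) UT) => P UP minP.
have [v vP] : exists v, v \in P.
  by apply/set0Pn; apply: contraNneq U0 => <-.
have Uv : U [set v].
  have dv : [disjoint [set v] & P :\ v] by rewrite disjoints1 !inE eqxx.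
  have := UU _ _ dv; rewrite setD1K // UP => /esym/orP[//|/minP].
  by rewrite (cardsD1 v P) vP add1n ltnn.
exists v => Q; have [vQ|vQ] := boolP (v \in Q).
  have dv : [disjoint [set v] & Q :\ v] by rewrite disjoints1 !inE eqxx.
  by rewrite -(setD1K vQ) UU // Uv.
have dv : [disjoint [set v] & Q] by rewrite disjoints1.
by have := UD _ _ dv; rewrite Uv => /negbTE.
Qed.

Fixpoint translate (S S' : signature)
    (J : forall f : sym S', term S 'I_(arity f)) (V : Type) (t : term S' V) :
    term S V :=
  match t with
  | Var v => Var S v
  | App f ts => subst (fun i => translate J (ts i)) (J f)
  end.

Definition derived (S S' : signature) (T : Type) (A : algebra S T)
    (J : forall f : sym S', term S 'I_(arity f)) : algebra S' T :=
  fun f x => eval A (tnth x) (J f).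

Arguments derived {S S' T} A J _ _.

Lemma eval_translate (S S' : signature) (T : Type) (A : algebra S T)
    (J : forall f : sym S', term S 'I_(arity f)) (V : Type) (e : V -> T)
    (t : term S' V) :
  eval (derived A J) e t = eval A e (translate J t).
Proof.
elim: t => //= f ts IH; rewrite eval_subst; apply: eval_ext => i.
by rewrite tnth_mktuple.
Qed.

Definition term_signature (S : signature) (N : nat)
    (F : term S 'I_N -> Prop) : signature :=
  @Signature {t | F t} (fun=> N).

Definition term_algebra (S : signature) (T : Type) (A : algebra S T) (N : nat)
    (F : term S 'I_N -> Prop) : algebra (term_signature F) T :=
  derived A (fun f : sym (term_signature F) => sval f).

Arguments term_algebra {S T} A {N} F _ _.

Record symmetric_ideal (S : signature) (N : nat) (F : term S 'I_N -> Prop) :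
    Prop := SymmetricIdeal {
  ideal_inhabited : exists t, F t;
  ideal_perm : forall t (s : {perm 'I_N}), F t -> F (rename s t);
  ideal_subst : forall (V : finType) (s : term S V) g,
    (forall v, F (g v)) -> F (subst g s) }.

(* Evaluate the terms of F at the tuples e_i = (b, .., a at i, .., b), where the
   members of F act as projections modulo c.  As N > |T| + 1, some t in F takes
   the same value c1 at two tuples e_i1, e_i2 whose class is that of b, and a
   value c0 at e_i0 in the class of a.  Substituting permuted copies of t shows
   that for every term s the sets P of variables with s(c0 on P, c1 off P) in
   the class of a form an ultrafilter, hence a choice of one variable of s. *)
Lemma symmetric_ideal_Taylor (S : signature) (T : finType) (A : algebra S T)
    (N : nat) (F : term S 'I_N -> Prop) :
  idempotent_algebra A -> Taylor A -> #|T| + 2 <= N -> symmetric_ideal F ->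
  Taylor (term_algebra A F).
Proof.
move=> idA tA leN [[t Ft] Fperm Fsubst]; apply: contrapT.
have idF : idempotent_algebra (term_algebra A F).
  move=> f x; rewrite -[RHS](eval_idem x (sval f) idA).
  by apply: eval_ext => i; rewrite tnth_mktuple.
move=> /not_Taylor_two_class_projective[k [X' [c' /(two_class_projective_power idF)]]].
move=> [X [c [hX [b bX cb] [a aX ca] hp]]] {k X' c'}.
have hpF s : F s -> exists i, forall e : 'I_N -> T, (forall j, e j \in X) ->
    c (eval A e s) = c (e i).
  move=> Fs; have [i hi] := hp (exist _ s Fs); exists i => e eX.
  have := hi [tuple e j | j < N]; rewrite tnth_mktuple => <-.
    by congr c; apply: eval_ext => j; rewrite tnth_mktuple.
  by move=> j; rewrite tnth_mktuple.
pose e_ (i j : 'I_N) := if j == i then a else b.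
have eX i j : e_ i j \in X by rewrite /e_; case: ifP.
have ce i j : c (e_ i j) = (j != i).
  by rewrite /e_; case: eqP => //= _; apply/negbTE.
pose w i := eval A (e_ i) t.
have [i0 hi0] := hpF t Ft.
have cw i : c (w i) = (i0 != i) by rewrite /w hi0.
(* Pigeonhole: the [N - 1] indices other than [i0] outnumber the elements of [T]. *)
have [i1 [i2 [i10 i20 i12 w12]]] : exists i1 i2,
    [/\ i1 != i0, i2 != i0, i1 != i2 & w i1 = w i2].
  apply: contrapT => nex.
  have inj : {in [set~ i0] &, injective w}.
    move=> i j; rewrite !inE => ii0 ji0 wij; apply: contrapT => ij.
    by apply: nex; exists i, j; split => //; apply/eqP.
  have := max_card (mem (w @: [set~ i0])); rewrite card_in_imset //.
  rewrite cardsC1 card_ord => leT.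
  have := leq_trans leN (leqSpred N); rewrite addn2 ltnS => ltT.
  by have := leq_trans ltT leT; rewrite ltnn.
pose U V (s : term S V) (P : pred V) :=
  ~~ c (eval A (fun v => if P v then w i0 else w i1) s).
have part (V : finType) (s : term S V) (P Q : {set V}) : [disjoint P & Q] ->
    ~~ (U V s (mem P) && U V s (mem Q)) /\
    U V s (mem (~: (P :|: Q))) = ~~ (U V s (mem P) || U V s (mem Q)).
  move=> dPQ.
  (* The blocks [P], [Q] and the rest are marked [i0], [i1], [i2]. At [e_ i] with [i] one of these
     marks, [t'] computes [s] with [w i0] on the block marked [i] and [w i1 = w i2] elsewhere. As
     [t'] depends on one variable [j] modulo [c], exactly one block lies in [U]. *)
  pose q v := if v \in P then i0 else if v \in Q then i1 else i2.
  pose t' := subst (fun v => rename (tperm i0 (q v)) t) s.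
  have Ft' : F t' by apply: Fsubst => v; apply: Fperm.
  have [j hj] := hpF t' Ft'.
  have wE i : eval A (e_ i) t' = eval A (fun v => w (tperm i0 (q v) i)) s.
    rewrite eval_subst; apply: eval_ext => v; rewrite eval_rename.
    apply: eval_ext => l; rewrite /= /e_; congr (if _ then a else b).
    by apply/eqP/eqP => [<-|->]; rewrite tpermK.
  have cwE i : c (eval A (fun v => w (tperm i0 (q v) i)) s) = (j != i).
    by rewrite -wE hj.
  have UP : U V s (mem P) = (j == i0).
    rewrite -[RHS]negbK -cwE; congr (~~ c _); apply: eval_ext => v.
    by rewrite tpermL /q /=; case: (v \in P) => //; case: (v \in Q).
  have UQ : U V s (mem Q) = (j == i1).
    rewrite -[RHS]negbK -cwE; congr (~~ c _); apply: eval_ext => v.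
    rewrite /q /=; have [vP|vP] := boolP (v \in P).
      by rewrite tperm1 perm1 (disjointFr dPQ vP).
    case: (v \in Q); first by rewrite tpermR.
    by rewrite tpermD // eq_sym.
  have UR : U V s (mem (~: (P :|: Q))) = (j == i2).
    rewrite -[RHS]negbK -cwE; congr (~~ c _); apply: eval_ext => v.
    rewrite /q /= !inE; have [vP|vP] := boolP (v \in P).
      by rewrite tperm1 perm1.
    case: (v \in Q); first by rewrite tpermD // eq_sym.
    by rewrite tpermR.
  (* No transposition moves any other [j], so [t'] would take the value [w j] at [e_ j], whose class
     is that of [b], contrary to [cwE]. *)
  have j012 : [|| j == i0, j == i1 | j == i2].
    apply: contraT; rewrite !negb_or => /and3P[j0 j1 j2].
    have := cwE j; rewrite eqxx (@eval_ext _ _ _ _ _ (fun=> w j)).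
      by rewrite eval_idem // cw eq_sym j0.
    move=> v; rewrite tpermD //; first by rewrite eq_sym.
    by rewrite eq_sym /q; case: ifP => // _; case: ifP.
  rewrite UP UQ UR; case/or3P: j012 => /eqP ->; rewrite ?eqxx ?orbT.
  - by rewrite !(eq_sym i0) (negbTE i10) (negbTE i20).
  - by rewrite (negbTE i10) (negbTE i12).
  - by rewrite (negbTE i20) (eq_sym i2) (negbTE i12).
have U0 (V : finType) (s : term S V) : U V s (mem set0) = false.
  rewrite /U (@eval_ext _ _ _ _ _ (fun=> w i1)) ?eval_idem ?cw 1?eq_sym ?i10 //.
  by move=> v; rewrite /= inE.
have ex_xi (V : finType) (s : term S V) :
    exists v, forall P : {set V}, U V s (mem P) = (v \in P).
  have UC (P : {set V}) : U V s (mem (~: P)) = ~~ U V s (mem P).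
    have [|_] := part V s P set0; first by rewrite -setI_eq0 setI0.
    by rewrite setU0 U0 orbF.
  apply: principal_ultrafilter.
  - by rewrite U0.
  - by rewrite -setC0 UC U0.
  - move=> P Q dPQ; have [_] := part V s P Q dPQ.
    by rewrite UC => /negb_inj.
  - by move=> P Q dPQ; have [] := part V s P Q dPQ.
pose xi V s := projT1 (cid (ex_xi V s)).
have xiP V s (P : {set V}) : U V s (mem P) = (xi V s \in P).
  by rewrite /xi; case: cid.
apply: (@Taylor_coordinate_choice _ _ A xi) => //; split.
  move=> V s s' ss'; apply/eqP; rewrite -in_set1 -xiP /U ss' -/(U V s' _).
  by rewrite (xiP V s') inE.
move=> V W h s; apply/eqP; rewrite -in_set1 -xiP /U eval_rename.
transitivity (U V s (mem (h @^-1: [set h (xi V s)]))).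
  by congr (~~ c _); apply: eval_ext => v; rewrite /= !inE.
by rewrite xiP !inE eqxx.
Qed.

(* By minimality the clone of A is generated by the ideal of all terms that act
   on the image of psi as the symmetric operation u does. *)
Theorem minimal_Taylor_symmetric_term (S S' : signature) (T : finType)
    (Y Z : Type) (A : algebra S T) (B : algebra S Y) (C : algebra S' Z)
    (psi : Z -> Y) (N : nat) (u : term S' 'I_N)
    (J : forall f : sym S', term S 'I_(arity f)) :
  idempotent_algebra A -> minimal_Taylor A -> models A B ->
  idempotent_algebra B ->
  (forall f z, eval B (psi \o tnth z) (J f) = psi (C f z)) ->
  #|T| + 2 <= N ->
  (forall (s : {perm 'I_N}) z, eval C (z \o s) u = eval C z u) ->
  forall (V : finType) (s : term S V), exists s' : term S' V, forall z,
    eval B (psi \o z) s = psi (eval C z s').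
Proof.
move=> idA [tA minA] mB idB hJ leN usym V s.
pose F (t : term S 'I_N) :=
  forall z, eval B (psi \o z) t = psi (eval C z u).
have trE W (r : term S' W) z :
    eval B (psi \o z) (translate J r) = psi (eval C z r).
  elim: r => //= f ts IH; rewrite eval_subst -hJ; apply: eval_ext => i.
  by rewrite IH /= tnth_mktuple.
have symF : symmetric_ideal F.
  split.
  - by exists (translate J u).
  - move=> t p Ft z; rewrite eval_rename -(usym p).
    exact: (Ft (z \o p)).
  move=> W r g Fg z; rewrite eval_subst -[RHS](eval_idem _ r idB).
  by apply: eval_ext => v; apply: Fg.
have /contrapT subF : ~ ~ clone_sub A (term_algebra A F).
  move=> ncl; apply: (minA _ (term_algebra A F) _ ncl).
    by move=> f; exists (sval f).
  exact: symmetric_ideal_Taylor.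
elim: s => [v|f ts IH]; first by exists (Var S' v).
have [|r hr] := subF _ (A f).
  exists (App (f:=f) (@Var S _)) => x; congr (A f _).
  by apply: eq_from_tnth => i; rewrite tnth_mktuple.
have {}hr : same_op A (App (f:=f) (@Var S _))
    (translate (fun g : sym (term_signature F) => sval g) r).
  move=> e; rewrite -eval_translate /= hr; apply: eval_ext => i.
  by rewrite tnth_mktuple.
(* The operation [f] of [A] is a composition [r] of members of [F]. Each of them acts on the image
   of [psi] as [u] does, so [u] may replace them all. *)
pose r' := translate (fun _ : sym (term_signature F) => u) r : term S' 'I_(arity f).
have rE z : eval B (psi \o z) (App (f:=f) (@Var S _)) = psi (eval C z r').
  rewrite (models_same_op mB hr) /r'; elim: (r) => //= g us IHu.
  by rewrite !eval_subst -(svalP g); apply: eval_ext => i /=; rewrite IHu.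
exists (subst (fun i => projT1 (cid (IH i))) r') => z.
rewrite eval_subst -rE /=; congr (B f _); apply: eq_from_tnth => i.
by rewrite !tnth_mktuple /=; case: cid => s' /= ->.
Qed.

(** * Semilattice and majority edges *)

Lemma models_trans (S : signature) (T T' T'' : Type) (A : algebra S T)
    (B : algebra S T') (C : algebra S T'') :
  models A B -> models B C -> models A C.
Proof. by move=> [mAB] [mBC]; split=> V s t /mAB/mBC. Qed.

Lemma models_idempotent (S : signature) (T T' : Type) (A : algebra S T)
    (B : algebra S T') :
  models A B -> idempotent_algebra A -> idempotent_algebra B.
Proof.
move=> mAB idA f x.
have hA : same_op A (App (f:=f) (fun=> Var S tt)) (Var S tt).
  by move=> e; rewrite -[RHS](eval_idem _ (App (f:=f) (fun=> Var S tt)) idA).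
exact: (models_same_op mAB hA (fun=> x)).
Qed.

Lemma models_subalg (S : signature) (T : finType) (A : algebra S T)
    (X : {set T}) (hX : subuniverse A X) : models A (subalg hX).
Proof.
split=> V s t st e; apply: val_inj.
by rewrite !(@eval_hom _ _ _ (subalg hX) A val) // st.
Qed.

Lemma eval_quotient (S : signature) (T : choiceType) (A : algebra S T)
    (theta : congruence A) (V : Type) (e : V -> T) (t : term S V) :
  block theta (eval A e t) = eval (quotient_alg theta) (block theta \o e) t.
Proof. by apply: eval_hom => f x; rewrite quotient_alg_block. Qed.

Lemma block_surj (S : signature) (T : choiceType) (A : algebra S T)
    (theta : congruence A) (q : quotient_carrier theta) :
  exists x, q = block theta x.
Proof. by exists (repr (q : {eq_quot (con_rel theta)}%qT)); rewrite /block reprK. Qed.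

Lemma models_quotient (S : signature) (T : choiceType) (A : algebra S T)
    (theta : congruence A) : models A (quotient_alg theta).
Proof.
split=> V s t st e; pose e' v := projT1 (cid (block_surj (e v))).
have eE : e =1 block theta \o e' by move=> v; rewrite /e' /=; case: cid.
by rewrite !(eval_ext _ _ eE) -!eval_quotient st.
Qed.

Definition prod_alg (S : signature) (T T' : Type) (A : algebra S T)
    (B : algebra S T') : algebra S (T * T') :=
  fun f x => (A f [tuple of map fst x], B f [tuple of map snd x]).

Arguments prod_alg {S T T'} A B _ _.

Lemma eval_prod (S : signature) (T T' : Type) (A : algebra S T)
    (B : algebra S T') (V : Type) (e : V -> T * T') (t : term S V) :
  eval (prod_alg A B) e t = (eval A (fst \o e) t, eval B (snd \o e) t).
Proof.
rewrite -(@eval_hom _ _ _ (prod_alg A B) A fst) //.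
by rewrite -(@eval_hom _ _ _ (prod_alg A B) B snd) // -surjective_pairing.
Qed.

Lemma models_prod (S : signature) (T T' T'' : Type) (A : algebra S T)
    (B : algebra S T') (C : algebra S T'') :
  models A B -> models A C -> models A (prod_alg B C).
Proof.
move=> [mB] [mC]; split=> V s t st e.
by rewrite !eval_prod (mB _ _ _ st) (mC _ _ _ st).
Qed.

Lemma Sg_term (S : signature) (T : finType) (A : algebra S T) (a b x : T) :
  x \in Sg A a b ->
  exists t : term S bool, x = eval A (fun c : bool => if c then b else a) t.
Proof.
pose P x := exists t : term S bool, x = eval A (fun c : bool => if c then b else a) t.
move=> /bigcapP/(_ [set x | `[< P x >]]); move=> h.
suff : x \in [set x | `[< P x >]] by rewrite inE => /asboolP.
apply: h; apply/asboolP; split; last first.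
  split; rewrite inE; apply/asboolP; first by exists (Var S false).
  by exists (Var S true).
move=> f xs hxs.
have {}hxs i : P (tnth xs i) by have := hxs i; rewrite inE => /asboolP.
rewrite inE; apply/asboolP; exists (App (fun i => projT1 (cid (hxs i)))) => /=.
congr (A f _); apply: eq_from_tnth => i.
by rewrite tnth_mktuple; case: cid.
Qed.

(** * Blocks of the two generators of an edge *)

Section Edge.

Variables (S : signature) (T : finType) (A : algebra S T) (a b : T).
Hypothesis idA : idempotent_algebra A.

Implicit Type theta : congruence (Sg_alg A a b).

(** [true] stands for [b], so that the top of [semilattice2] goes to the block of [b]. *)
Definition generator_block theta (c : bool) : quotient_carrier theta :=
  block theta (if c then gen_right A a b else gen_left A a b).

Lemma models_Sg_quotient theta : models A (quotient_alg theta).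
Proof. exact: models_trans (models_subalg _) (models_quotient _). Qed.

Lemma idempotent_Sg_quotient theta : idempotent_algebra (quotient_alg theta).
Proof. exact: models_idempotent (models_Sg_quotient _) idA. Qed.

(** The term depends on [x] only and serves all congruences at once; uniqueness compares two of
    them. *)
Lemma Sg_carrier_term (x : Sg_carrier A a b) :
  exists t : term S bool, forall theta,
    block theta x = eval (quotient_alg theta) (generator_block theta) t.
Proof.
have [t xE] := Sg_term (valP x); exists t => theta.
rewrite -[RHS]eval_quotient; congr (block theta _); apply: val_inj.
rewrite xE (@eval_hom _ _ _ (Sg_alg A a b) A val) //; apply: eval_ext => c /=.
by case: c.
Qed.

(** If the generators were congruent, idempotence would put every term in them, hence the whole
    generated subalgebra, into one block. *)
Lemma generator_block_inj theta : proper theta -> injective (generator_block theta).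
Proof.
move=> ptheta.
suff h : generator_block theta true <> generator_block theta false.
  by case=> -[] // /esym.
move=> h; apply: ptheta => x y; rewrite -block_eq.
have bE z : block theta z = generator_block theta true.
  have [t ->] := Sg_carrier_term z.
  rewrite -[RHS](eval_idem _ t (@idempotent_Sg_quotient theta)).
  by apply: eval_ext => -[].
by rewrite !bE.
Qed.

Lemma two_block_maximal theta : proper theta ->
  (forall x, exists c, block theta x = generator_block theta c) ->
  maximal_congruence theta.
Proof.
move=> ptheta twob; split => // psi ppsi sub x y.
apply/idP/idP => [psixy|]; last exact: sub.
apply: contrapT => nxy; apply: ppsi.
pose g c := if c then gen_right A a b else gen_left A a b.
have [[cx hx] [cy hy]] := (twob x, twob y).
have cxy : cy = ~~ cx.
  apply: contra_notP nxy => h; rewrite -block_eq hx hy.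
  by case: (cx) (cy) h => -[] // [].
have hg z c : block theta z = generator_block theta c -> psi z (g c).
  by move=> h; apply: sub; rewrite -block_eq h.
have psig c : psi (g cx) (g c).
  have [->|cc] := eqVneq c cx; first exact: equiv_refl.
  have -> : c = cy by rewrite cxy; case: (c) (cx) cc => -[].
  apply: (equiv_trans (y := x)); first by rewrite equiv_sym hg.
  by apply: (equiv_trans (y := y)) => //; apply: hg.
have psigx z : psi (g cx) z.
  have [c hz] := twob z.
  by apply: equiv_trans (psig c) _; rewrite equiv_sym hg.
by move=> z w; apply: equiv_trans (psigx w); rewrite equiv_sym.
Qed.

End Edge.

(** * Term equivalence with an algebra that has one basic operation *)

Lemma one_symbol_term_equivalent (S : signature) (Y Z : Type) (B : algebra S Y)
    (k : nat) (C : algebra (one_symbol k) Z) (psi : Z -> Y) (phi : Y -> Z)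
    (J : term S 'I_k) :
  cancel psi phi -> cancel phi psi ->
  (forall z : k.-tuple Z, eval B (psi \o tnth z) J = psi (C tt z)) ->
  (forall (V : finType) (s : term S V), exists s' : term (one_symbol k) V,
     forall z, eval B (psi \o z) s = psi (eval C z s')) ->
  term_equivalent_via B C phi.
Proof.
move=> psiK phiK hJ hs; split; first by exists psi.
move=> n g g' gg'; split=> [[t gE]|[t g'E]].
  have [s' hs'] := hs _ t; exists s' => y.
  have -> : y = [tuple of map phi (map_tuple psi y)].
    by apply: eq_from_tnth => i; rewrite !tnth_map psiK.
  rewrite -gg' gE -[RHS]psiK -hs'; congr phi; apply: eval_ext => i /=.
  by rewrite !tnth_map phiK.
exists (translate (fun _ : sym (one_symbol k) => J) t) => x; rewrite -[LHS]phiK gg' g'E.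
elim: t {g'E} => [v|[] ts IH] /=; first by rewrite tnth_map phiK.
rewrite eval_subst -hJ; apply: eval_ext => i /=.
by rewrite tnth_mktuple IH.
Qed.

Definition realizes (S : signature) (Y Z : Type) (B : algebra S Y) (k : nat)
    (C : algebra (one_symbol k) Z) (psi : Z -> Y) (J : term S 'I_k) : Prop :=
  forall z : 'I_k -> Z,
    eval B (psi \o z) J = psi (C tt [tuple z i | i < k]).

(** Arbitrarily large arities are asked for because [symmetric_ideal_Taylor] wants at least
    [#|T| + 2] variables. *)
Definition has_symmetric_terms (S : signature) (Z : Type) (C : algebra S Z) :
    Prop :=
  forall m, exists N (u : term S 'I_N), m <= N /\
    forall (s : {perm 'I_N}) z, eval C (z \o s) u = eval C z u.

Lemma minimal_Taylor_realizes (S : signature) (T : finType) (Y Z : Type)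
    (A : algebra S T) (B : algebra S Y) (k : nat)
    (C : algebra (one_symbol k) Z) (psi : Z -> Y) (J : term S 'I_k) :
  idempotent_algebra A -> minimal_Taylor A -> models A B ->
  has_symmetric_terms C -> realizes B C psi J ->
  forall (V : finType) (s : term S V), exists s' : term (one_symbol k) V,
    forall z, eval B (psi \o z) s = psi (eval C z s').
Proof.
move=> idA minA mAB symC rJ; have [N [u [leN usym]]] := symC (#|T| + 2).
apply: (minimal_Taylor_symmetric_term (J := fun _ : sym (one_symbol k) => J)
          idA minA mAB (models_idempotent mAB idA) _ leN usym) => -[] z.
rewrite rJ; congr (psi (C tt _)); apply: eq_from_tnth => i.
by rewrite tnth_mktuple.
Qed.

Lemma eval_preserves (S : signature) (Z : Type) (C : algebra S Z)
    (R : Z -> Z -> Prop) (V : Type) (e e' : V -> Z) (s : term S V) :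
  (forall f x y, (forall i, R (tnth x i) (tnth y i)) -> R (C f x) (C f y)) ->
  (forall v, R (e v) (e' v)) -> R (eval C e s) (eval C e' s).
Proof.
move=> RC Re; elim: s => //= f ts IH; apply: RC => i.
by rewrite !tnth_mktuple.
Qed.

Lemma symmetric_semilattice2 : has_symmetric_terms semilattice2.
Proof.
move=> m.
pose join (s t : term (one_symbol 2) 'I_m.+1) : term (one_symbol 2) 'I_m.+1 :=
  App (f := tt : sym (one_symbol 2)) (fun i : 'I_2 => if i == ord0 then s else t).
(* The seed repeats the variable [ord0], which is harmless since the join is idempotent. *)
pose u := foldr (fun i => join (Var _ i)) (Var _ ord0) (enum 'I_m.+1).
have uE z : eval semilattice2 z u = [exists i, z i].
  transitivity (has z (enum 'I_m.+1) || z ord0).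
    rewrite /u; elim: (enum _) => //= i l IH.
    by rewrite /semilattice2 !tnth_mktuple /= IH orbA.
  apply/orP/existsP => [[/hasP[i _ zi]|z0]|[i zi]]; first by exists i.
    by exists ord0.
  by left; apply/hasP; exists i; rewrite ?mem_enum.
exists m.+1, u; split=> // s z; rewrite !uE.
apply/existsP/existsP => -[i zi]; first by exists (s i).
by exists (s^-1%g i); rewrite /= permKV.
Qed.

(* Baker-Pixley: any two points have a coordinate where both take their majority
   value, and from three terms each failing at one of three points the majority
   term corrects all failures. *)
Lemma symmetric_majority2 : has_symmetric_terms majority2.
Proof.
(* An odd number of variables excludes ties, and two sets of more than [m] of them must meet. *)
move=> m; pose N := m.*2.+1.
pose maj (z : {ffun 'I_N -> bool}) := m < #|[set i | z i]|.
have majP (z : {ffun 'I_N -> bool}) : m < #|[set i | z i == maj z]|.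
  case mz : (maj z).
    rewrite -[X in X < _]/m; move: (mz); rewrite /maj => h.
    by rewrite (eq_card (B := [set i | z i])) // => i; rewrite !inE eqb_id.
  have -> : [set i | z i == false] = ~: [set i | z i].
    by apply/setP => i; rewrite !inE eqbF_neg.
  have := cardsC [set i | z i]; rewrite card_ord.
  by move: mz; rewrite /maj /N; lia.
have pair (z z' : {ffun 'I_N -> bool}) : exists i, z i = maj z /\ z' i = maj z'.
  have : [set i | z i == maj z] :&: [set i | z' i == maj z'] != set0.
    set P := [set i | z i == maj z]; set Q := [set i | z' i == maj z'].
    have leU : #|P :|: Q| <= N by rewrite -[leqRHS](card_ord N) max_card.
    have := cardsUI P Q; have := majP z; have := majP z'.
    by rewrite -/P -/Q -card_gt0 /N in leU *; lia.
  by case/set0Pn => i; rewrite !inE => /andP[/eqP hz /eqP hz']; exists i.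
have [u uE] : exists u : term (one_symbol 3) 'I_N, forall z : {ffun 'I_N -> bool},
    z \in enum {ffun 'I_N -> bool} -> eval majority2 z u = maj z.
  have [n] := ubnP (size (enum {ffun 'I_N -> bool})).
  elim: n (enum _) => // n IH [|x [|y [|w l]]] /=; rewrite ?ltnS => ln.
  - by exists (Var _ ord0).
  - have [i [hi _]] := pair x x; exists (Var _ i) => z; rewrite inE => /eqP -> //.
  - have [i [hi hi']] := pair x y; exists (Var _ i) => z.
    by rewrite !inE => /orP[] /eqP ->.
  have [u1 h1] := IH [:: y, w & l] ln.
  have [u2 h2] := IH [:: x, w & l] ln.
  have [u3 h3] := IH [:: x, y & l] ln.
  exists (App (f := tt : sym (one_symbol 3)) (fun i : 'I_3 => tnth [tuple u1; u2; u3] i)).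
  move=> z; rewrite !inE /= /majority2 !tnth_mktuple !(tnth_nth u1) /=.
  case/or4P => [/eqP ->|/eqP ->|/eqP ->|zl].
  - by rewrite h2 ?h3 ?inE ?eqxx //; case: (maj x); rewrite ?orbT ?andbF.
  - by rewrite h1 ?h3 ?inE ?eqxx ?orbT //; case: (maj y); rewrite ?orbT ?andbF.
  - by rewrite h1 ?h2 ?inE ?eqxx ?orbT //; case: (maj w); rewrite ?orbT ?andbF.
  - by rewrite h1 ?h2 ?h3 ?inE ?zl ?orbT //; case: (maj z).
exists N, u; split; first by rewrite /N; lia.
have uE' (z : 'I_N -> bool) : eval majority2 z u = maj [ffun i => z i].
  by rewrite -uE ?mem_enum //; apply: eval_ext => i; rewrite ffunE.
move=> s z; rewrite !uE' /maj; congr (m < _).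
rewrite -(card_imset _ (@perm_inj _ s)); apply: eq_card => i.
rewrite !inE ffunE; apply/imsetP/idP => [[j]|zi].
  by rewrite inE ffunE => zj ->.
by exists (s^-1%g i); rewrite ?inE ?ffunE /= permKV.
Qed.

(** * Witnesses of semilattice and majority edges *)

Section TwoElementEdges.

Variables (S : signature) (T : finType) (A : algebra S T) (a b : T).
Hypotheses (idA : idempotent_algebra A) (minA : minimal_Taylor A).

Implicit Type theta : congruence (Sg_alg A a b).

Section Realized.

Variables (k : nat) (C : algebra (one_symbol k) bool).
Hypothesis symC : has_symmetric_terms C.

Lemma realized_terms theta (J : term S 'I_k) :
  realizes (quotient_alg theta) C (@generator_block _ _ A a b theta) J ->
  forall (V : finType) (s : term S V), exists s' : term (one_symbol k) V,
    forall z, eval (quotient_alg theta) (@generator_block _ _ A a b theta \o z) s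
              = generator_block theta (eval C z s').
Proof.
exact: minimal_Taylor_realizes idA minA (models_Sg_quotient theta) symC.
Qed.

Lemma realized_two_block theta (J : term S 'I_k) :
  realizes (quotient_alg theta) C (@generator_block _ _ A a b theta) J ->
  forall x, exists c, block theta x = generator_block theta c.
Proof.
move=> rJ x; have [t ->] := Sg_carrier_term x.
have [t' tE] := realized_terms rJ t.
by exists (eval C id t'); rewrite -tE.
Qed.

Lemma realized_term_equivalent theta (J : term S 'I_k) :
  proper theta ->
  realizes (quotient_alg theta) C (@generator_block _ _ A a b theta) J ->
  exists2 phi : quotient_carrier theta -> bool,
    term_equivalent_via (quotient_alg theta) C phi
    & phi (block theta (gen_right A a b)) = true.
Proof.
move=> ptheta rJ.
pose phi q := q == generator_block theta true.
have psiK : cancel (@generator_block _ _ A a b theta) phi.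
  move=> c; rewrite /phi (inj_eq (generator_block_inj idA ptheta)).
  by case: c.
have phiK : cancel phi (@generator_block _ _ A a b theta).
  move=> q; have [x ->] := block_surj q.
  by have [c ->] := realized_two_block rJ x; rewrite psiK.
exists phi; last by rewrite -[RHS](psiK true).
apply: (one_symbol_term_equivalent (J := J) psiK phiK) (realized_terms rJ).
move=> z; rewrite rJ; congr (generator_block _ (@C tt _)).
by apply: eq_from_tnth => i; rewrite tnth_mktuple.
Qed.

(** In the product of the two quotients, the pairs of equally indexed generator blocks carry [C],
    realized by the same [J]. Every element is a term in the generators, so its two blocks have the
    same index [c]. *)
Lemma realized_unique theta theta' (J : term S 'I_k) :
  proper theta -> proper theta' ->
  realizes (quotient_alg theta) C (@generator_block _ _ A a b theta) J ->
  realizes (quotient_alg theta') C (@generator_block _ _ A a b theta') J ->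
  theta' =2 theta.
Proof.
move=> pt pt' rJ rJ'.
pose B := prod_alg (quotient_alg theta) (quotient_alg theta').
pose psi c := (generator_block theta c, generator_block theta' c).
have mB : models A B by apply: models_prod; apply: models_Sg_quotient.
have rB : realizes B C psi J.
  by move=> z; rewrite eval_prod (rJ z) (rJ' z).
have hx x : exists c, block theta x = generator_block theta c /\
                      block theta' x = generator_block theta' c.
  have [t tE] := Sg_carrier_term x.
  have [t' t'E] := minimal_Taylor_realizes idA minA mB symC rB t.
  exists (eval C id t'); have := t'E id.
  by rewrite eval_prod /psi !tE => -[-> ->].
move=> x y; rewrite -!block_eq.
have [[c [-> ->]] [d [-> ->]]] := (hx x, hx y).
by rewrite !(inj_eq (generator_block_inj idA _)).
Qed.

End Realized.

Lemma in_generator_blocksP theta (q : quotient_carrier theta) :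
  in_generator_blocks q <-> exists c, q = generator_block theta c.
Proof.
split=> [[->|->]|[[] ->]]; [by exists false|by exists true|by right|by left].
Qed.

Lemma semilattice_witness_realizes theta : semilattice_witness theta ->
  proper theta /\ exists J : term S 'I_2,
    realizes (quotient_alg theta) semilattice2 (@generator_block _ _ A a b theta) J.
Proof.
move=> [pt [g [J gE] [_ gi gC _ [_ gt]]]]; split=> //; exists J => z.
have P c : in_generator_blocks (generator_block theta c).
  by apply/in_generator_blocksP; exists c.
transitivity (g [tuple generator_block theta (z ord0); generator_block theta (z ord_max)]).
  rewrite gE; apply: eval_ext => -[[|[|//]] hi];
  by rewrite (tnth_nth (generator_block theta true)) /=;
     congr (generator_block _ (z _)); apply: val_inj.
rewrite /semilattice2 !tnth_mktuple.
have -> : z 0%R = z ord0 by congr z; apply: val_inj.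
have -> : z 1%R = z ord_max by congr z; apply: val_inj.
have gtop c : g [tuple generator_block theta c; generator_block theta true] =
              generator_block theta true.
  exact: gt (P c).
case: (z ord0) (z ord_max) => -[] //=; first by rewrite gC.
exact: gi (P false).
Qed.

Lemma majority_witness_realizes theta : majority_witness theta ->
  proper theta /\ exists J : term S 'I_3,
    realizes (quotient_alg theta) majority2 (@generator_block _ _ A a b theta) J.
Proof.
move=> [pt [g [J gE] gm]]; split=> //; exists J => z.
have P c : in_generator_blocks (generator_block theta c).
  by apply/in_generator_blocksP; exists c.
pose i1 : 'I_3 := Ordinal (isT : 1 < 3).
transitivity (g [tuple generator_block theta (z ord0); generator_block theta (z i1);
                       generator_block theta (z ord_max)]).
  rewrite gE; apply: eval_ext => -[[|[|[|//]]] hi];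
  by rewrite (tnth_nth (generator_block theta true)) /=;
     congr (generator_block _ (z _)); apply: val_inj.
rewrite /majority2 !tnth_mktuple.
have -> : z 0%R = z ord0 by congr z; apply: val_inj.
have -> : z 1%R = z i1 by congr z; apply: val_inj.
have -> : z 2%:R%R = z ord_max by congr z; apply: val_inj.
have gm' c d := gm _ _ (P c) (P d).
have [? ? ?] := gm' true false; have [? ? ?] := gm' false true.
have [? _ _] := gm' true true; have [? _ _] := gm' false false.
by case: (z ord0) (z i1) (z ord_max) => -[] [].
Qed.

(* K = J'(J(x, y), J(y, x)): at a point x <> y, one of the two values of J is true
   modulo theta' because terms of the semilattice preserve the relation x || y. *)
Lemma semilattice_common_term theta theta' (J J' : term S 'I_2) :
  realizes (quotient_alg theta) semilattice2 (@generator_block _ _ A a b theta) J ->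
  realizes (quotient_alg theta') semilattice2 (@generator_block _ _ A a b theta') J' ->
  exists K : term S 'I_2,
  realizes (quotient_alg theta) semilattice2 (@generator_block _ _ A a b theta) K /\
  realizes (quotient_alg theta') semilattice2 (@generator_block _ _ A a b theta') K.
Proof.
(* The renamings give [J(x, y)] for [i = 0] and [J(y, x)] for [i = 1]. Modulo [theta] both are the
   join, and [J'] is idempotent. *)
move=> rJ rJ'; pose sw (i j : 'I_2) : 'I_2 := if i == ord0 then j else rev_ord j.
have swK (i : 'I_2) : rev_ord (rev_ord i) = i by rewrite rev_ordK.
have r01 : rev_ord (0%R : 'I_2) = 1%R by apply: val_inj.
have r10 : rev_ord (1%R : 'I_2) = 0%R by apply: val_inj.
exists (subst (fun i => rename (sw i) J) J'); split=> z.
  rewrite eval_subst.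
  rewrite -[RHS](eval_idem _ J' (idempotent_Sg_quotient idA (theta := theta))).
  apply: eval_ext => i; rewrite eval_rename (rJ (z \o sw i)).
  congr (generator_block _ _); rewrite /semilattice2 !tnth_mktuple /= /sw.
  by case: eqP => // _; rewrite r01 r10 orbC.
have [s sE] := realized_terms symmetric_semilattice2 rJ' J.
rewrite eval_subst; pose f i := eval semilattice2 (z \o sw i) s.
rewrite (@eval_ext _ _ _ _ _ (generator_block theta' \o f)); last first.
  by move=> i; rewrite eval_rename; apply: (sE (z \o sw i)).
rewrite rJ'; congr (generator_block _ _); rewrite /semilattice2 !tnth_mktuple /f.
have idS : idempotent_algebra semilattice2.
  by move=> [] x; rewrite /semilattice2 !tnth_mktuple orbb.
have z2 : z =1 fun i => if i == 0%R then z 0%R else z 1%R.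
  by move=> -[[|[|//]] hi] /=; congr z; apply: val_inj.
have [z01|z01] := eqVneq (z 0%R) (z 1%R).
  have zE i : z \o sw i =1 fun=> z 1%R.
    by move=> j /=; rewrite z2 z01; case: ifP.
  by rewrite !(eval_ext _ _ (zE _)) !eval_idem // z01.
transitivity true; last by case: (z 0%R) (z 1%R) z01 => -[].
apply: (@eval_preserves _ _ semilattice2 (fun x y => x || y)).
  move=> [] x y hxy; have := hxy 0%R; have := hxy 1%R; rewrite /semilattice2.
  by case: (tnth x 0%R) (tnth x 1%R) (tnth y 0%R) (tnth y 1%R) => -[] [] [].
move=> i; rewrite /= /sw eqxx; have -> : (1%R == ord0 :> 'I_2) = false by [].
have -> : z (rev_ord i) = if i == 0%R then z 1%R else z 0%R.
  by case: i => -[|[|//]] hi /=; congr z; apply: val_inj.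
rewrite [z i]z2; case: (i == 0%R); case: (z 0%R) (z 1%R) z01 => -[] //.
Qed.

(** [K] applies [J'] to the three cyclic shifts of [J]. Modulo [theta] the shifts agree, and [J'] is
    idempotent. Modulo [theta'], [J] acts as a term of the majority algebra; such terms preserve the
    relation [x = m] or [y = m], with [m] the majority value, so at most one shift differs from [m],
    and [J'] corrects it. *)
Lemma majority_common_term theta theta' (J J' : term S 'I_3) :
  realizes (quotient_alg theta) majority2 (@generator_block _ _ A a b theta) J ->
  realizes (quotient_alg theta') majority2 (@generator_block _ _ A a b theta') J' ->
  exists K : term S 'I_3,
  realizes (quotient_alg theta) majority2 (@generator_block _ _ A a b theta) K /\
  realizes (quotient_alg theta') majority2 (@generator_block _ _ A a b theta') K.
Proof.
move=> rJ rJ'.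
have ord3 (p : 'I_3) : [\/ p = 0%R, p = 1%R | p = 2%:R%R].
  by case: p => -[|[|[|//]]] hp;
     [apply: Or31|apply: Or32|apply: Or33]; apply: val_inj.
exists (subst (fun i => rename (fun j => (i + j)%R) J) J'); split=> z.
  rewrite eval_subst.
  rewrite -[RHS](eval_idem _ J' (idempotent_Sg_quotient idA (theta := theta))).
  apply: eval_ext => i; rewrite eval_rename (rJ (z \o _)).
  congr (generator_block _ _); rewrite /majority2 !tnth_mktuple /=.
  have [->|->|->] := ord3 i; rewrite ?GRing.add0r //.
    rewrite GRing.addr0.
    have -> : (1 + 1 = 2%:R :> 'I_3)%R by apply: val_inj.
    have -> : (1 + 2%:R = 0 :> 'I_3)%R by apply: val_inj.
    by case: (z 0%R) (z 1%R) (z 2%:R%R) => -[] [].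
  rewrite GRing.addr0.
  have -> : (2%:R + 1 = 0 :> 'I_3)%R by apply: val_inj.
  have -> : (2%:R + 2%:R = 1 :> 'I_3)%R by apply: val_inj.
  by case: (z 0%R) (z 1%R) (z 2%:R%R) => -[] [].
have [s sE] := realized_terms symmetric_majority2 rJ' J.
rewrite eval_subst; pose f i := eval majority2 (z \o (fun j => (i + j)%R)) s.
rewrite (@eval_ext _ _ _ _ _ (generator_block theta' \o f)); last first.
  by move=> i; rewrite eval_rename; apply: (sE (z \o _)).
rewrite rJ'; congr (generator_block _ _).
set m := RHS.
have zm p q : p != q -> (z p == m) || (z q == m).
  have [->|->|->] := ord3 p; have [->|->|->] := ord3 q; rewrite ?eqxx // => _;
  rewrite /m /majority2 !tnth_mktuple;
  by case: (z 0%R) (z 1%R) (z 2%:R%R) => -[] [].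
have fm i k : i != k -> (f i == m) || (f k == m).
  move=> ik; apply: (@eval_preserves _ _ majority2 (fun x y => (x == m) || (y == m))).
    move=> [] x y hxy; have := hxy 0%R; have := hxy 1%R; have := hxy 2%:R%R.
    rewrite /majority2.
    by case: (m) (tnth x 0%R) (tnth x 1%R) (tnth x 2%:R%R) (tnth y 0%R)
        (tnth y 1%R) (tnth y 2%:R%R) => -[] [] [] [] [] [].
  by move=> j; apply: zm => /=; rewrite (inj_eq (GRing.addIr j)).
have := fm 0%R 1%R isT; have := fm 0%R 2%:R%R isT; have := fm 1%R 2%:R%R isT.
rewrite /majority2 !tnth_mktuple.
by case: (m) (f 0%R) (f 1%R) (f 2%:R%R) => -[] [] [].
Qed.

Lemma semilattice_witness_unique theta theta' :
  semilattice_witness theta -> semilattice_witness theta' -> theta' =2 theta.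
Proof.
move=> /semilattice_witness_realizes[pt [J rJ]].
move=> /semilattice_witness_realizes[pt' [J' rJ']].
have [K [rK rK']] := semilattice_common_term rJ rJ'.
exact: (realized_unique symmetric_semilattice2 pt pt' rK rK').
Qed.

Lemma majority_witness_unique theta theta' :
  majority_witness theta -> majority_witness theta' -> theta' =2 theta.
Proof.
move=> /majority_witness_realizes[pt [J rJ]].
move=> /majority_witness_realizes[pt' [J' rJ']].
have [K [rK rK']] := majority_common_term rJ rJ'.
exact: (realized_unique symmetric_majority2 pt pt' rK rK').
Qed.

Lemma semilattice_witness_maximal theta :
  semilattice_witness theta -> maximal_congruence theta.
Proof.
move=> /semilattice_witness_realizes[pt [J rJ]].
exact: two_block_maximal pt (realized_two_block symmetric_semilattice2 rJ).
Qed.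

Lemma majority_witness_maximal theta :
  majority_witness theta -> maximal_congruence theta.
Proof.
move=> /majority_witness_realizes[pt [J rJ]].
exact: two_block_maximal pt (realized_two_block symmetric_majority2 rJ).
Qed.

End TwoElementEdges.

(** * A Malcev term for abelian algebras *)

Definition term_condition (S : signature) (Y : Type) (B : algebra S Y) : Prop :=
  forall (V : finType) (t : term S V) (P : pred V) (x x' u v : V -> Y),
    eval B (fun i => if P i then x i else u i) t =
    eval B (fun i => if P i then x i else v i) t ->
    eval B (fun i => if P i then x' i else u i) t =
    eval B (fun i => if P i then x' i else v i) t.

(** Evaluate [t] in the square at the pairs [(x i, x i)] on [P] and [(u i, v i)] elsewhere. Diagonal
    pairs are all related by [beta], so passing from [x] to [x'] stays in one block. *)
Lemma abelian_term_condition (S : signature) (Y : Type) (B : algebra S Y) :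
  abelian_algebra B -> term_condition B.
Proof.
move=> [beta [z zP]] V t P x x' u v.
have evalP e (j : 'I_2) :
    tnth (eval (power B 2) e t) j = eval B (fun i => tnth (e i) j) t.
  rewrite (@eval_hom _ _ _ (power B 2) B (fun w => tnth w j)) // => f w.
  rewrite tnth_mktuple; congr (B f _); apply: eq_from_tnth => i.
  by rewrite tnth_mktuple tnth_map.
pose E x i := if P i then [tuple x i; x i] else [tuple u i; v i] : 2.-tuple Y.
have E0 y : tnth (eval (power B 2) (E y) t) 0%R =
            eval B (fun i => if P i then y i else u i) t.
  by rewrite evalP; apply: eval_ext => i; rewrite /E; case: ifP.
have E1 y : tnth (eval (power B 2) (E y) t) 1%R =
            eval B (fun i => if P i then y i else v i) t.
  by rewrite evalP; apply: eval_ext => i; rewrite /E; case: ifP.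
rewrite -!E0 -!E1 => /zP zx; apply/zP; rewrite (equiv_ltrans zx).
apply: (@eval_preserves _ _ (power B 2) (fun y w => beta y w)).
  by move=> f y w; apply: con_compat.
move=> i; rewrite /E; case: ifP => _; last exact: equiv_refl.
apply: (equiv_trans (y := z)); last exact/zP.
by rewrite equiv_sym; apply/zP.
Qed.

(** Pigeonhole on the iterates. As [l] is positive, [iter l h x] lies in the range of [h], yet it
    merges with [x] after [m] steps: a bad point is traded for one with a property that [h]
    enforces. *)
Lemma iter_collision (Y : finType) (h : Y -> Y) (x : Y) :
  exists m l, [/\ 0 < m, 0 < l & iter m h (iter l h x) = iter m h x].
Proof.
apply: contrapT => nex.
have inj : injective (fun i : 'I_#|Y|.+1 => iter i.+1 h x).
  suff lt_inj (i j : 'I_#|Y|.+1) : i < j -> iter i.+1 h x <> iter j.+1 h x.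
    move=> i j eij; apply: val_inj; case: (ltngtP i j) => // [ij|ji].
      by case: (lt_inj _ _ ij).
    by case: (lt_inj _ _ ji).
  move=> ij eij; apply: nex; exists i.+1, (j - i); split=> //.
    by rewrite subn_gt0.
  by rewrite -iterD eij addSn subnKC // ltnW.
by have := leq_card _ inj; rewrite card_ord ltnn.
Qed.

Definition star (S : signature) (V W : Type) (t : term S V) (u : term S W) :
    term S (V * W) := subst (fun v => rename (pair v) u) t.

Lemma eval_star (S : signature) (Y : Type) (B : algebra S Y) (V W : Type)
    (t : term S V) (u : term S W) e :
  eval B e (star t u) = eval B (fun v => eval B (fun w => e (v, w)) u) t.
Proof.
by rewrite eval_subst; apply: eval_ext => v; rewrite eval_rename.
Qed.

(** * Transitive terms and rectangularity of compatible relations *)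

Section Abelian.

Variables (S : signature) (Y : finType) (D : algebra S Y).
Hypotheses (idD : idempotent_algebra D) (tcD : term_condition D).
Hypothesis nontrivialD : forall xi, ~ coordinate_choice D xi.

Section TransitiveTerm.

Variables (X : {set Y}) (d : Y).
Hypotheses (closedX : subuniverse D X) (dX : d \in X).

Lemma eval_mem V (e : V -> Y) (t : term S V) :
  (forall v, e v \in X) -> eval D e t \in X.
Proof. by move=> eX; apply: (@eval_closed _ _ D (fun y => y \in X)). Qed.

Definition absorbs (W : {set Y}) (V : finType) (t : term S V) (i : V) : Prop :=
  forall e, (forall v, e v \in X) -> e i \in W -> eval D e t \in W.

(* If i and j absorb, then p(x, y) = t(x at i, y elsewhere) absorbs W in both
   arguments.  Iterating y -> p(d, y) moves some y outside W to a point y' of W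
   with p^m(d, y') = p^m(d, y), and the term condition turns d into y. *)
Lemma absorbs_unique (W : {set Y}) (V : finType) (t : term S V) (i j : V) :
  d \in W -> W \proper X -> absorbs W t i -> absorbs W t j -> i = j.
Proof.
move=> dW /properP[sWX [y yX yW]] ti tj; apply: contrapT => /eqP ij.
pose e x u (v : V) : Y := if v == i then x else u.
pose p x u := eval D (e x u) t.
(* [q m] expresses the [m]-th iterate of [p x] as a term, with [x] read off at [i] and the start
   value at [j]. *)
pose q := fix q m := if m is m'.+1 then
  subst (fun v => if v == i then Var S i else q m') t else Var S j.
have qE m x u : eval D (e x u) (q m) = iter m (p x) u.
  elim: m => [|m IH] /=; first by rewrite /e eq_sym (negbTE ij).
  rewrite eval_subst; apply: eval_ext => v; rewrite {2}/e.
  by case: ifP => _ //; rewrite /= /e eqxx.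
have eX x u v : x \in X -> u \in X -> e x u v \in X by rewrite /e; case: ifP.
have [m [l [_ l0 ml]]] := iter_collision (p d) y.
have piX n : iter n (p d) y \in X.
  by elim: n => //= n IH; apply: eval_mem => v; apply: eX.
have lW : iter l (p d) y \in W.
  case: (l) l0 => //= n _; apply: ti; last by rewrite /e eqxx.
  by move=> v; apply: eX.
have := @tcD V (q m) (pred1 i) (fun=> d) (fun=> y)
  (fun=> iter l (p d) y) (fun=> y).
rewrite -!/(e _ _) !qE => /(_ ml).
have -> : iter m (p y) y = y.
  elim: (m) => //= n ->; rewrite /p -[RHS](eval_idem _ t idD).
  by apply: eval_ext => v; rewrite /e; case: ifP.
move=> yE; move/negP: yW; apply; rewrite -yE.
elim: (m) => //= n IH; apply: tj; last by rewrite /e eq_sym (negbTE ij).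
by move=> v; apply: eX => //; apply: (subsetP sWX).
Qed.

(** If every term absorbed [W] at some variable, that variable would be unique by [absorbs_unique],
    hence a coordinate choice. *)
Lemma escaping_term (W : {set Y}) : d \in W -> W \proper X ->
  exists (V : finType) (t : term S V), forall i, ~ absorbs W t i.
Proof.
move=> dW pWX; apply: contrapT => nex.
have ex_i (V : finType) (t : term S V) : exists i, absorbs W t i.
  by apply: contrapT => ni; apply: nex; exists V, t => i ti; apply: ni; exists i.
pose xi V t := projT1 (cid (ex_i V t)).
have xiP V t : absorbs W t (xi V t) by rewrite /xi; case: cid.
apply: (@nontrivialD xi); split=> [V s t st|V W' h t].
  apply: (absorbs_unique dW pWX (xiP V s)) => e eX eW.
  by rewrite st; apply: xiP.
apply: (absorbs_unique dW pWX (xiP W' _)) => e eX eW.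
by rewrite eval_rename; apply: xiP => // v; apply: eX.
Qed.

(** A term without variables has one value, while idempotence makes it equal to both [d] and a point
    outside [W]. *)
Lemma escaping_inhabited (W : {set Y}) (V : finType) (t : term S V) :
  d \in W -> W \proper X -> inhabited V.
Proof.
move=> dW /properP[_ [y _ yW]]; apply: contrapT => nV; move/negP: yW; apply.
rewrite -(eval_idem y t idD) (@eval_ext _ _ _ _ _ (fun=> d)) ?eval_idem //.
by move=> v; case: nV.
Qed.

(** If [star t' t] absorbs a set at [(k, i)], then by idempotence [t'] absorbs it at [k] and [t] at
    [i]. So composing the terms found for the single sets [W] escapes all of them. *)
Lemma uniform_escaping_term : exists (V : finType) (t : term S V),
  inhabited V /\
  forall W : {set Y}, d \in W -> W \proper X -> forall i, ~ absorbs W t i.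
Proof.
suff [V [t [iV tP]]] : exists (V : finType) (t : term S V), inhabited V /\
    forall W, W \in enum {set Y} -> d \in W -> W \proper X ->
    forall i, ~ absorbs W t i.
  by exists V, t; split=> // W; apply: tP; rewrite mem_enum.
elim: (enum _) => [|W l [V [t [[v0] tP]]]].
  by exists unit, (Var S tt); split=> //; exact: (inhabits tt).
have [[dW pWX]|nW] := pselect (d \in W /\ W \proper X); last first.
  exists V, t; split=> [|W']; first exact: (inhabits v0).
  rewrite inE => /orP[/eqP -> dW pWX|W'l]; last exact: tP.
  by case: nW.
have [V' [t' t'P]] := escaping_term dW pWX.
have [v1] := escaping_inhabited t' dW pWX.
exists (V' * V)%type, (star t' t); split; first exact: (inhabits (v1, v0)).
move=> W'; rewrite inE => /orP[/eqP ->|W'l] dW' pW'X [k i] ti.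
  apply: (t'P k) => e eX eW; have := ti (e \o fst); rewrite eval_star.
  rewrite (@eval_ext _ _ _ _ _ e); last by move=> v; rewrite /= eval_idem.
  by apply=> // -[v w]; apply: eX.
apply: (tP W' W'l dW' pW'X i) => e eX eW; have := ti (e \o snd).
by rewrite eval_star /= eval_idem //; apply=> // -[v w]; apply: eX.
Qed.

(* Each composition with the escaping term enlarges, at every coordinate, the
   set of values reachable with d at that coordinate. *)
Lemma transitive_term : exists (V : finType) (t : term S V),
  inhabited V /\ forall i y, y \in X ->
    exists e : V -> Y, [/\ forall v, e v \in X, e i = d & eval D e t = y].
Proof.
have [G [g [[g0] gP]]] := uniform_escaping_term.
pose reach (V : finType) (t : term S V) i := [set y | `[< exists e : V -> Y,
  [/\ forall v, e v \in X, e i = d & eval D e t = y] >]].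
have reachP (V : finType) (t : term S V) i y : reflect (exists e : V -> Y,
    [/\ forall v, e v \in X, e i = d & eval D e t = y]) (y \in reach V t i).
  by rewrite inE; apply: asboolP.
suff /(_ #|Y|)[V [t [iV tP]]] : forall n, exists (V : finType) (t : term S V),
    inhabited V /\ forall i, X \subset reach V t i \/ n < #|reach V t i|.
  exists V, t; split=> // i y yX; apply/reachP.
  by case: (tP i) => [/subsetP/(_ y yX)//|]; rewrite ltnNge max_card.
elim=> [|n [V [t [[v0] tP]]]].
  exists unit, (Var S tt); split=> [|[]]; first exact: (inhabits tt).
  right; rewrite card_gt0; apply/set0Pn; exists d; apply/reachP.
  by exists (fun=> d).
exists (G * V)%type, (star g t); split; first exact: (inhabits (g0, v0)).
move=> [k i].
have sub : reach V t i \subset reach _ (star g t) (k, i).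
  apply/subsetP => y /reachP[e [eX ei ey]]; apply/reachP.
  by exists (e \o snd); split=> [[v w]||]; rewrite ?eval_star //= ?eval_idem.
have [XW|nXW] := boolP (X \subset reach V t i).
  by left; apply: subset_trans sub.
right; case: (tP i) => [|ltn]; first by rewrite (negbTE nXW).
apply: (leq_ltn_trans ltn); apply: proper_card; rewrite properE sub /=.
have dW : d \in reach V t i.
  by apply/reachP; exists (fun=> d); rewrite eval_idem.
have WX : reach V t i \subset X.
  by apply/subsetP => y /reachP[e [eX _ <-]]; apply: eval_mem.
(* Were nothing gained, [g] would absorb the old set at [k]: its argument at [k] is a value of [t]
   with [d] at [i], and every other copy of [t] is fed a constant. *)
apply/negP => /subsetP sub'; apply: (gP _ dW _ k) => [|e eX /reachP[e' [e'X e'i e'k]]].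
  by rewrite properE WX.
apply: sub'; apply/reachP; exists (fun p => if p.1 == k then e' p.2 else e p.1).
split=> /= [[v w] /=||]; first by case: ifP.
  by rewrite eqxx.
rewrite eval_star; apply: eval_ext => v /=.
by case: eqP => [->|_] //; rewrite eval_idem.
Qed.

End TransitiveTerm.

Definition update (V : eqType) (e : V -> Y) (i : V) (x : Y) : V -> Y :=
  fun v => if v == i then x else e v.

(* The set Z of the points x related to the whole of X = R[a] contains a, and a
   transitive term absorbs Z inside the inverse image of d; in an abelian
   algebra this forces Z to be everything. *)
Lemma abelian_rectangular (R : Y -> Y -> Prop) (a b c d : Y) :
  (forall f x y, (forall i, R (tnth x i) (tnth y i)) -> R (@D f x) (@D f y)) ->
  R a c -> R a d -> R b d -> R b c.
Proof.
move=> RD Rac Rad Rbd.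
have Rt (V : Type) (e e' : V -> Y) t : (forall v, R (e v) (e' v)) ->
  R (eval D e t) (eval D e' t) by apply: eval_preserves.
pose X := [set y | `[< R a y >]].
have XP y : reflect (R a y) (y \in X) by rewrite inE; apply: asboolP.
have closedX : subuniverse D X.
  move=> f x hx; apply/XP; rewrite -(idD f a); apply: RD => i.
  by rewrite tnth_mktuple; apply/XP.
pose Z x := R x d /\ forall y, y \in X -> R x y.
suff Zb : Z b by case: Zb => _; apply; apply/XP.
have Za : Z a by split=> // y /XP.
pose abs (V : finType) (h : term S V) := forall i e, (forall v, R (e v) d) ->
  (forall v, v != i -> Z (e v)) -> Z (eval D e h).
have dX : d \in X by apply/XP.
have [V [t [[i0] tP]]] := transitive_term closedX dX.
(* The argument at [i] is only known to be related to [d]. Each [y] in [X] is a value of [t] at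
   points of [X] with [d] at [i], and the other arguments are related to all of [X]. *)
have abs_t : abs V t.
  move=> i e eC eZ; split; first by rewrite -(eval_idem d t idD); apply: Rt.
  move=> y /(tP i)[e' [e'X e'i <-]]; apply: Rt => v.
  have [->|vi] := eqVneq v i; first by rewrite e'i.
  by have [_] := eZ v vi; apply.
pose equ (h : term S V) i x' :=
  forall e, eval D (update e i b) h = eval D (update e i x') h.
(* Treat the variables one by one: iterating [h] in its variable [i] makes [b] and some point of [Z]
   interchangeable at [i] and keeps what was achieved before. *)
have [h [abs_h hP]] : exists h, abs V h /\
    forall i, i \in enum V -> exists2 x', Z x' & equ h i x'.
  elim: (enum V) => [|i l [h [abs_h hP]]]; first by exists t.
  pose q := fix q m := if m is m'.+1 then
    subst (fun v => if v == i then q m' else Var S v) h else Var S i.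
  have qS m e : eval D e (q m.+1) = eval D (update e i (eval D e (q m))) h.
    by rewrite /= eval_subst; apply: eval_ext => v; rewrite /update; case: ifP.
  pose phi u := eval D (update (fun=> a) i u) h.
  have qE m u : eval D (update (fun=> a) i u) (q m) = iter m phi u.
    elim: m => [|m IH]; first by rewrite /= /update eqxx.
    rewrite qS IH; apply: eval_ext => v; rewrite /update.
    by case: (v == i).
  have phiZ u : R u d -> Z (phi u).
    move=> Ru; apply: (abs_h i) => v; first by rewrite /update; case: ifP.
    by rewrite /update => /negbTE ->.
  (* [iter k phi b] is in [Z] and has the same [m]-th iterate as [b]; the term condition then allows
     arbitrary values in place of the parameters [a]. *)
  have [m [k [m0 k0 mk]]] := iter_collision phi b.
  have iterC n : R (iter n phi b) d by elim: n => //= n /phiZ[].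
  have kZ : Z (iter k phi b) by case: (k) k0 => //= n _; apply: phiZ.
  exists (q m); split.
    move=> j e eC eZ.
    (* If [i] is itself the exempt position [j], the value of [q 0] may lie outside [Z], but that of
       every later [q n] is inside; this is why [m] must be positive. *)
    have inv n : R (eval D e (q n)) d /\ (j != i -> Z (eval D e (q n))) /\
        Z (eval D e (q n.+1)).
      have step w : R w d -> (j != i -> Z w) -> Z (eval D (update e i w) h).
        move=> wC wZ; apply: (abs_h j) => v; rewrite /update.
          by case: ifP.
        have [->|_] := eqVneq v i; last exact: eZ.
        by rewrite eq_sym.
      elim: n => [|n [IHC [IHZ IHS]]].
        split; first exact: eC.
        have e0Z : j != i -> Z (e i) by move=> ji; apply: eZ; rewrite eq_sym.
        by split=> //; rewrite qS; apply: step => //; apply: eC.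
      split; first by case: IHS.
      split=> //; rewrite qS; apply: step => //; by case: IHS.
    by case: (m) m0 => // n _; have [_ []] := inv n.
  move=> j; rewrite inE; have [-> _|ji /= jl] := eqVneq j i.
    exists (iter k phi b) => // e; apply: esym.
    have updE e' u : update e' i u =1 fun v => if predC1 i v then e' v else u.
      by move=> v; rewrite /update /=; case: eqP.
    rewrite !(eval_ext _ _ (updE _ _)); apply: (tcD (x := fun=> a)).
    by rewrite -!(eval_ext _ _ (updE _ _)) !qE.
  have [x' x'Z jx'] := hP j jl; exists x' => // e.
  elim: (m) => [|n IH]; first by rewrite /= /update eq_sym (negbTE ji).
  rewrite !qS IH; set w := eval D _ (q n).
  have updC u : update (update e j u) i w =1 update (update e i w) j u.
    move=> v; rewrite /update; case: (eqVneq v i) => [->|//].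
    by rewrite eq_sym (negbTE ji).
  by rewrite !(eval_ext _ _ (updC _)).
have {}hP i : exists x', Z x' /\ equ h i x'.
  by have [|x'] := hP i; rewrite ?mem_enum //; exists x'.
pose x' i := projT1 (cid (hP i)).
have x'Z i : Z (x' i) by rewrite /x'; case: cid => ? [].
have x'E i : equ h i (x' i) by rewrite /x'; case: cid => ? [].
(* Idempotence gives [h(b, .., b) = b]; exchanging [b] for [x' v] one variable at a time writes [b]
   as [h] of points of [Z]. *)
have eval_x' (l : seq V) : eval D (fun v => if v \in l then x' v else b) h = b.
  elim: l => [|i l IH]; first by rewrite eval_idem.
  pose f v := if v \in l then x' v else b; rewrite -[RHS]IH -/f.
  have [il|il] := boolP (i \in l).
    by apply: eval_ext => v; rewrite inE; case: eqP => // ->; rewrite /f il.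
  transitivity (eval D (update f i (x' i)) h).
    by apply: eval_ext => v; rewrite inE /update; case: eqP => [->|].
  rewrite -x'E; apply: eval_ext => v; rewrite /update /f.
  by case: eqP => // ->; rewrite (negbTE il).
rewrite -(eval_x' (enum V)); apply: (abs_h i0) => v; rewrite mem_enum.
  by case: (x'Z v).
by move=> _; apply: x'Z.
Qed.

End Abelian.

(** * Powers over a finite index set and the Malcev term *)

Definition ffun_power (S : signature) (I : finType) (Y : Type)
    (B : algebra S Y) : algebra S {ffun I -> Y} :=
  fun f x => [ffun i => B f [tuple tnth x k i | k < arity f]].

Arguments ffun_power {S} I {Y} B _ _.

Lemma eval_ffun_power (S : signature) (I : finType) (Y : Type)
    (B : algebra S Y) (V : Type) (e : V -> {ffun I -> Y}) (t : term S V) i :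
  eval (ffun_power I B) e t i = eval B (fun v => e v i) t.
Proof.
rewrite (@eval_hom _ _ _ (ffun_power I B) B (fun w => w i)) // => f w.
rewrite ffunE; congr (B f _); apply: eq_from_tnth => k.
by rewrite tnth_mktuple tnth_map.
Qed.

Lemma models_ffun_power (S : signature) (I : finType) (Y : Type)
    (B : algebra S Y) : models B (ffun_power I B).
Proof.
split=> V s t st e; apply/ffunP => i.
by rewrite !eval_ffun_power st.
Qed.

Lemma term_condition_ffun_power (S : signature) (I : finType) (Y : Type)
    (B : algebra S Y) : term_condition B -> term_condition (ffun_power I B).
Proof.
move=> tcB V t P x x' u v /ffunP h; apply/ffunP => i.
have push (y w : V -> {ffun I -> Y}) :
    eval (ffun_power I B) (fun k => if P k then y k else w k) t i =
    eval B (fun k => if P k then y k i else w k i) t.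
  by rewrite eval_ffun_power; apply: eval_ext => k; case: ifP.
rewrite !push; apply: (tcB _ _ _ (fun k => x k i)).
by rewrite -!push.
Qed.

Lemma coordinate_choice_models (S : signature) (T T' : Type)
    (A : algebra S T) (B : algebra S T') xi :
  models A B -> coordinate_choice B xi -> coordinate_choice A xi.
Proof. by move=> mAB [xiE xiR]; split=> // V s t /(models_same_op mAB)/xiE. Qed.

(** In the power indexed by [Y * Y] the two projections [x] and [y] generate the binary term
    operations. The relation [R] generated by [(x, x)], [(x, y)], [(y, y)] is rectangular, so it
    contains [(y, x)], and the term producing that pair is a Malcev term. *)
Theorem abelian_Malcev_term (S : signature) (T Y : finType) (A : algebra S T)
    (B : algebra S Y) :
  idempotent_algebra A -> Taylor A -> models A B -> abelian_algebra B ->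
  exists t : term S 'I_3, forall x y,
    eval B (tnth [tuple x; x; y]) t = y /\ eval B (tnth [tuple x; y; y]) t = x.
Proof.
move=> idA tA mAB /abelian_term_condition tcB.
pose D := ffun_power (Y * Y)%type B.
have mAD : models A D := models_trans mAB (models_ffun_power _ B).
pose x : {ffun Y * Y -> Y} := [ffun p => p.1].
pose y : {ffun Y * Y -> Y} := [ffun p => p.2].
pose R u v := exists t : term S 'I_3,
  u = eval D (tnth [tuple x; x; y]) t /\ v = eval D (tnth [tuple x; y; y]) t.
have R3 (i : 'I_3) : R (tnth [tuple x; x; y] i) (tnth [tuple x; y; y] i).
  by exists (Var S i).
have [t [tx ty]] : R y x.
  apply: (@abelian_rectangular _ _ D _ _ _ R x y x y).
  - exact: models_idempotent mAD idA.
  - exact: term_condition_ffun_power.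
  - move=> xi /(coordinate_choice_models mAD).
    exact: Taylor_coordinate_choice.
  - move=> f u v h; exists (App (fun i => projT1 (cid (h i)))).
    split; rewrite /=; congr (D f _); apply: eq_from_tnth => i;
    by rewrite tnth_mktuple; case: cid => ? [].
  - exact: (R3 ord0).
  - exact: (R3 (Ordinal (isT : 1 < 3))).
  - exact: (R3 ord_max).
exists t => a b; split.
  transitivity (y (a, b)); last by rewrite ffunE.
  rewrite tx eval_ffun_power; apply: eval_ext => -[[|[|[|//]]] hi];
  by rewrite !(tnth_nth a) !(tnth_nth x) /= ffunE.
transitivity (x (a, b)); last by rewrite ffunE.
rewrite ty eval_ffun_power; apply: eval_ext => -[[|[|[|//]]] hi];
by rewrite !(tnth_nth a) !(tnth_nth x) /= ffunE.
Qed.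

(** * Abelian edges *)

Section MalcevGroup.

Variables (S : signature) (Y : finType) (B : algebra S Y) (t : term S 'I_3).

Let m x y z := eval B (tnth [tuple x; y; z]) t.

Hypothesis tcB : term_condition B.
Hypothesis mxxy : forall x y, m x x y = y.
Hypothesis mxyy : forall x y, m x y y = x.

(** Constants enter as extra variables indexed by [Y] itself, which is finite, so that
    [term_condition] applies. *)
Let binary_polynomial (F : Y -> Y -> Y) : Prop :=
  exists s : term S (bool + Y), forall x z, F x z = eval B (fun v =>
    match v with inl true => x | inl false => z | inr c => c end) s.

Let polynomial_fst : binary_polynomial (fun x _ => x).
Proof. by exists (Var S (inl true)). Qed.

Let polynomial_snd : binary_polynomial (fun _ z => z).
Proof. by exists (Var S (inl false)). Qed.

Let polynomial_cst c : binary_polynomial (fun _ _ => c).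
Proof. by exists (Var S (inr c)). Qed.

Let polynomial_malcev F G H :
  binary_polynomial F -> binary_polynomial G -> binary_polynomial H ->
  binary_polynomial (fun x z => m (F x z) (G x z) (H x z)).
Proof.
move=> [f fE] [g gE] [h hE]; exists (subst (tnth [tuple f; g; h]) t) => x z.
rewrite eval_subst fE gE hE; apply: eval_ext => -[[|[|[|//]]] hi];
by rewrite !(tnth_nth x) !(tnth_nth f).
Qed.

Let polynomial_condition F x x' z z' : binary_polynomial F ->
  F x z = F x z' -> F x' z = F x' z'.
Proof.
move=> [s sE]; rewrite !sE.
pose e (w : Y) (v : bool + Y) := if v is inr c then c else w.
have eE u w : (fun v : bool + Y =>
    match v with inl true => u | inl false => w | inr c => c end)
   =1 fun v => if pred1 (inl true) v then e u v else e w v.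
  by case=> [[]|c].
rewrite !(eval_ext B _ (eE _ _)).
exact: (@tcB _ s (pred1 (inl true)) (e x) (e x') (e z) (e z')).
Qed.

(** For [x = y] the left side is [w] whatever [z] is; by the term condition it is then independent
    of [z] for every [x], and [z = y] gives the right side. *)
Let malcev_left x y z w : m (m x y z) z w = m x y w.
Proof.
rewrite -[RHS](mxyy (m x y w) w) mxyy.
have FP : binary_polynomial (fun x z => m (m x y z) z w).
  by do ![apply: polynomial_malcev|exact: polynomial_fst
         |exact: polynomial_snd|exact: polynomial_cst].
have := @polynomial_condition _ y x z y FP.
by rewrite !mxxy !mxyy; apply.
Qed.

(** Likewise: for [v = u] the left side is [x] whatever [y] is; then put [y = u]. *)
Let malcev_right x y u v : m x y (m y u v) = m x u v.
Proof.
have FP : binary_polynomial (fun v y => m x y (m y u v)).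
  by do ![apply: polynomial_malcev|exact: polynomial_fst
         |exact: polynomial_snd|exact: polynomial_cst].
have := @polynomial_condition _ u v y u FP.
by rewrite !mxyy !mxxy; apply.
Qed.

Variable o : Y.

Let add x y := m x o y.
Let opp x := m o x o.

Let addA : associative add.
Proof.
by move=> x y z; rewrite /add -(malcev_right (m x o y) y) malcev_left.
Qed.

(* x + z - x = z holds for x = 0 and does not depend on x, since it does not
   for z = 0. *)
Let addC : commutative add.
Proof.
move=> x z; rewrite /add.
have FP : binary_polynomial (fun z x => m (m x o z) x o).
  by do ![apply: polynomial_malcev|exact: polynomial_fst
         |exact: polynomial_snd|exact: polynomial_cst].
have := @polynomial_condition _ o z x o FP.
rewrite !mxyy !mxxy => /(_ erefl) zE.
by rewrite -[in RHS]zE malcev_left mxyy.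
Qed.

Let add0 : left_id o add.
Proof. by move=> x; apply: mxxy. Qed.

Let addN : left_inverse o opp add.
Proof. by move=> x; rewrite /add /opp malcev_left mxyy. Qed.

Lemma abelian_Malcev_group : exists (G : zmodType) (phi : Y -> G),
  [/\ bijective phi, phi o = 0%R &
      forall x y z, phi (m x y z) = (phi x - phi y + phi z)%R].
Proof.
pose G : zmodType := HB.pack (Finite.sort Y) (GRing.isZmodule.Build Y addA addC add0 addN).
exists G, id; split=> //; first by exists id.
move=> x y z; change (m x y z = add (add x (opp y)) z).
by rewrite /add /opp malcev_right malcev_left.
Qed.

End MalcevGroup.

(** * Symmetric affine terms and finite cyclic groups *)

Lemma symmetric_affine_malcev (G : zmodType) (n : nat) :
  0 < n -> (forall x : G, (x *+ n = 0)%R) -> has_symmetric_terms (affine_malcev G).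
Proof.
(* With [N + 1] variables, the affine term [z 0] plus all [z i - z 0] is the full sum minus [N]
   times [z 0], and [n] divides [N]. *)
move=> n0 nG l; pose N := n * l.
pose op (s t u : term (one_symbol 3) 'I_N.+1) : term (one_symbol 3) 'I_N.+1 :=
  App (f := tt : sym (one_symbol 3)) (fun i : 'I_3 => tnth [tuple s; t; u] i).
pose u := foldr (fun i s => op s (Var _ ord0) (Var _ i)) (Var _ ord0) (enum 'I_N.+1).
have uE z : eval (affine_malcev G) z u = (\sum_i z i)%R.
  transitivity (z ord0 + \sum_(i <- enum 'I_N.+1) (z i - z ord0))%R.
    rewrite /u; elim: (enum _) => [|i s IH] /=; first by rewrite big_nil GRing.addr0.
    rewrite /affine_malcev !tnth_mktuple !(tnth_nth (Var _ ord0)) /= IH big_cons.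
    by rewrite [(z i - _ + _)%R]addrC -!addrA; congr (_ + (_ + _))%R; apply: addrC.
  rewrite big_enum /= big_split /= sumrN sumr_const card_ord mulrS /N mulrnA nG mul0rn.
  by rewrite addr0 addrCA subrr addr0.
exists N.+1, u; split; first by rewrite /N ltnW // ltnS leq_pmull.
by move=> s z; rewrite !uE [RHS](reindex_inj (@perm_inj _ s)).
Qed.

(** Chinese remaindering for the order of [g], which replaces [n] as the least positive exponent
    killing [g]. *)
Lemma cyclic_isomorphic_to_prod_Z (G : zmodType) (g : G) (n : nat) :
  0 < n -> (g *+ n = 0)%R -> g <> 0%R -> (forall x, exists k, x = g *+ k)%R ->
  exists (r : nat) (p k : 'I_r -> nat),
    [/\ 0 < r, injective p, forall j, prime (p j) /\ 0 < k j
      & isomorphic_to_prod_Z G (fun j => p j ^ k j)].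
Proof.
move=> n0 gn g0 gen.
have exn : exists n, (0 < n) && (g *+ n == 0)%R by exists n; rewrite n0 gn eqxx.
case: (ex_minnP exn) => {n n0 gn exn} n /andP[n0 /eqP gn] minn.
have gmod k : (g *+ k = g *+ (k %% n))%R.
  by rewrite {1}(divn_eq k n) mulrnDr mulnC mulrnA gn mul0rn add0r.
have g_eq0 k : (g *+ k = 0)%R -> n %| k.
  rewrite gmod => gk; apply: contraT; rewrite /dvdn -lt0n => k0.
  have := minn (k %% n); rewrite k0 gk eqxx => /(_ isT).
  by rewrite leqNgt ltn_pmod.
have g_eq k l : (g *+ k = g *+ l)%R -> k = l %[mod n].
  wlog kl : k l / k <= l.
    by move=> h; case/orP: (leq_total k l) => kl; [|move/esym]; move/(h _ _ kl).
  move=> gkl; apply/eqP; rewrite eq_sym eqn_mod_dvd //; apply: g_eq0.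
  by rewrite mulrnBr // gkl subrr.
have n1 : 1 < n.
  rewrite ltn_neqAle n0 andbT; apply/eqP => n1; apply: g0.
  by rewrite -[LHS]mulr1n n1.
pose r := size (primes n); pose p (j : 'I_r) := nth 0 (primes n) j.
pose k j := logn (p j) n; pose q j := p j ^ k j.
have pP j : p j \in primes n by apply: mem_nth.
have prime_p j : prime (p j) by have := pP j; rewrite mem_primes => /and3P[].
have k0 j : 0 < k j by rewrite /k logn_gt0.
have q1 j : 1 < q j.
  by rewrite /q -(exp1n (k j)) ltn_exp2r // prime_gt1.
have qn j : q j %| n by rewrite /q pfactor_dvdn.
exists r, p, k; split=> //.
- have : pdiv n \in primes n by rewrite mem_primes pdiv_prime // n0 pdiv_dvd.
  by rewrite /r; case: (primes n).
- move=> i j /eqP; rewrite nth_uniq ?primes_uniq // => /eqP; exact: val_inj.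
pose F (i : nat) : {dffun forall j : 'I_r, 'Z_(q j)} := [ffun j => (i%:R)%R].
have FE i l : F i = F l <-> i = l %[mod n].
  split=> [/ffunP h|il]; last first.
    apply/ffunP => j; rewrite !ffunE; apply: val_inj => /=.
    rewrite !val_Zp_nat //.
    by rewrite -(modn_dvdm i (qn j)) il modn_dvdm.
  have {h} h j : i = l %[mod q j].
    by have := congr1 val (h j); rewrite !ffunE /= !val_Zp_nat.
  wlog il : i l h / i <= l.
    move=> h'; case/orP: (leq_total i l) => /h' il; [|apply: esym];
    by apply: il => j; rewrite h.
  apply/eqP; rewrite eq_sym eqn_mod_dvd //; apply/dvdn_partP => // p0 p0n.
  have p0n' : p0 \in primes n by [].
  have jr : index p0 (primes n) < r by rewrite index_mem.
  have := h (Ordinal jr); rewrite /q /k /p /= nth_index // p_part => /esym/eqP.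
  by rewrite eqn_mod_dvd.
have inj_F : injective (fun i : 'I_n => F i).
  by move=> i l /FE; rewrite !modn_small // => /val_inj.
(* Surjectivity by counting: the [q j] are the prime powers in the factorization of [n]. *)
have [Finv FK FinvK] : bijective (fun i : 'I_n => F i).
  apply: inj_card_bij => //; rewrite card_ord card_dep_ffun foldrE big_map big_enum /=.
  rewrite (eq_bigr q); last by move=> j _; rewrite card_ord Zp_cast.
  rewrite [leqRHS](prod_prime_decomp n0) prime_decompE big_map /=.
  by rewrite (big_nth 0) big_mkord.
(* A chosen discrete logarithm to base [g]. It is determined only modulo [n], which is all that [F]
   sees. *)
pose dl x := projT1 (cid (gen x)).
have dlP x : x = (g *+ dl x)%R by rewrite /dl; case: cid.
have Fdl i : F (dl (g *+ i)%R) = F i by apply/FE/g_eq; rewrite -dlP.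
exists (fun x => F (dl x)); split.
  exists (fun v => g *+ Finv v)%R => [x|v]; last by rewrite Fdl FinvK.
  have : F (Finv (F (dl x))) = F (dl x) by rewrite FinvK.
  by move/FE => h; rewrite [RHS]dlP gmod h -gmod.
move=> x y j; rewrite {1}[x]dlP {1}[y]dlP -mulrnDr Fdl !ffunE natrD //.
Qed.

(** Translation by [x] permutes the group, so it does not change the sum of all elements. *)
Lemma mulrn_card_eq0 (Y : finType) (G : zmodType) (phi : Y -> G) (x : G) :
  bijective phi -> (x *+ #|Y| = 0)%R.
Proof.
move=> [psi phiK psiK].
have shift_inj : injective (fun y => psi (phi y + x)%R).
  by move=> y y' /(can_inj psiK)/addIr/(can_inj phiK).
have : (\sum_y phi y = \sum_y phi (psi (phi y + x)))%R.
  exact: reindex_inj shift_inj.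
under [RHS]eq_bigr do rewrite psiK.
rewrite big_split /= sumr_const => /eqP.
by rewrite eq_sym -subr_eq0 [X in (X - _)%R]addrC addrK => /eqP.
Qed.

Lemma abelian_witness_affine (S : signature) (T : finType) (A : algebra S T)
    (a b : T) (theta : congruence (Sg_alg A a b)) :
  idempotent_algebra A -> minimal_Taylor A -> abelian_witness theta ->
  exists (r : nat) (p k : 'I_r -> nat) (G : zmodType),
    [/\ 0 < r, injective p, forall j, prime (p j) /\ 0 < k j,
        isomorphic_to_prod_Z G (fun j => p j ^ k j)
      & term_equivalent (quotient_alg theta) (affine_malcev G)].
Proof.
move=> idA minA [ptheta abtheta]; have [tA _] := minA.
(* The quotient carrier is only a [choiceType]; its section [repr] into the finite subalgebra makes
   it finite. *)
pose Y : finType := can_type (@reprK _ {eq_quot (con_rel theta)}%qT).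
pose B : algebra S Y := quotient_alg theta.
have mAB : models A B := models_Sg_quotient theta.
have abB : abelian_algebra B := abtheta.
have [t tE] := abelian_Malcev_term idA tA mAB abB.
have [G [phi [bphi phi0 phiE]]] := abelian_Malcev_group
  (abelian_term_condition abB) (fun x y => proj1 (tE x y))
  (fun x y => proj2 (tE x y)) (generator_block theta false).
have [psi phiK psiK] := bphi.
have rB : realizes B (affine_malcev G) psi t.
  move=> z; rewrite /affine_malcev !tnth_mktuple -[LHS]phiK; congr psi.
  rewrite -[z 0%R]psiK -[z 1%R]psiK -[z 2%:R%R]psiK -phiE.
  congr phi; apply: eval_ext => -[[|[|[|//]]] hi];
  by rewrite (tnth_nth (psi (z 0%R))) /=; congr (psi (z _)); apply: val_inj.
have n0 : 0 < #|Y| by apply/card_gt0P; exists (generator_block theta false).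
have nG (x : G) : (x *+ #|Y| = 0)%R by exact: mulrn_card_eq0 bphi.
have hs := minimal_Taylor_realizes idA minA mAB (symmetric_affine_malcev n0 nG) rB.
pose g := phi (generator_block theta true).
have g0 : g <> 0%R.
  by rewrite -phi0 => /(can_inj phiK)/(generator_block_inj idA ptheta).
(* The block of [a] is zero and that of [b] is [g]. Every block is a term in these two, hence an
   affine term in [0] and [g]. *)
have gen x : exists k, (x = g *+ k)%R.
  have [y yE] := block_surj (psi x : quotient_carrier theta).
  have [s sE] := Sg_carrier_term y; have [s' s'E] := hs _ s.
  pose z (c : bool) := if c then g else 0%R : G.
  have -> : x = eval (affine_malcev G) z s'.
    apply: (can_inj psiK); rewrite -s'E yE sE; apply: eval_ext => c /=.
    by case: c; rewrite /z /g -?phi0 phiK.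
  apply: (@eval_closed _ _ (affine_malcev G) (fun x => exists k, x = g *+ k)%R)
    => [[] w hw|[]]; last 2 first.
  - by exists 1; rewrite mulr1n.
  - by exists 0; rewrite mulr0n.
  rewrite /affine_malcev.
  have [[[i ->] [j ->]] [l ->]] := (hw 0%R, hw 1%R, hw 2%:R%R).
  (* As [#|Y|] kills the group, [#|Y|.-1] serves as the coefficient -1. *)
  exists (i + j * #|Y|.-1 + l); rewrite !mulrnDr; congr (_ + _ + _)%R.
  apply/eqP; rewrite eq_sym -addr_eq0 -mulrnDr -mulnSr prednK // mulnC mulrnA nG.
  by rewrite mul0rn.
have [r [p [k [r0 pinj pk iso]]]] := cyclic_isomorphic_to_prod_Z n0 (nG g) g0 gen.
exists r, p, k, G; split=> //; exists phi.
apply: (one_symbol_term_equivalent (J := t) psiK phiK _ hs) => z.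
rewrite rB; congr (psi (affine_malcev G tt _)).
by apply: eq_from_tnth => i; rewrite tnth_mktuple.
Qed.

Theorem mainTheorem17 (S : signature) (T : finType) (A : algebra S T)
    (hidem : idempotent_algebra A) (hmin : minimal_Taylor A) (a b : T) :
  (forall theta : congruence (Sg_alg A a b),
     edge_witness theta ->
     [/\ semilattice_witness theta ->
           exists2 phi : quotient_carrier theta -> bool,
             term_equivalent_via (quotient_alg theta) semilattice2 phi
             & phi (block theta (gen_right A a b)) = true,
         majority_witness theta ->
           term_equivalent (quotient_alg theta) majority2
       & abelian_witness theta ->
           exists (r : nat) (p k : 'I_r -> nat) (G : zmodType),
             [/\ (0 < r)%N, injective p,
                 forall j, prime (p j) /\ (0 < k j)%N,
                 isomorphic_to_prod_Z G (fun j => (p j ^ k j)%N)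
               & term_equivalent (quotient_alg theta)
                   (affine_malcev G)]])
  /\ ((exists theta : congruence (Sg_alg A a b),
         semilattice_witness theta) ->
      exists theta : congruence (Sg_alg A a b),
        [/\ semilattice_witness theta,
            forall theta' : congruence (Sg_alg A a b),
              semilattice_witness theta' -> theta' =2 theta
          & maximal_congruence theta])
  /\ ((exists theta : congruence (Sg_alg A a b),
         majority_witness theta) ->
      exists theta : congruence (Sg_alg A a b),
        [/\ majority_witness theta,
            forall theta' : congruence (Sg_alg A a b),
              majority_witness theta' -> theta' =2 theta
          & maximal_congruence theta]).
Proof.
split; first move=> theta _.
  split=> [/semilattice_witness_realizes[pt [J rJ]]
          |/majority_witness_realizes[pt [J rJ]]|].
  - exact: (realized_term_equivalent hidem hmin symmetric_semilattice2 pt rJ).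
  - have [phi ? _] := realized_term_equivalent hidem hmin symmetric_majority2 pt rJ.
    by exists phi.
  - exact: abelian_witness_affine.
split=> -[theta wtheta]; exists theta; split=> //.
- by move=> theta'; apply: semilattice_witness_unique.
- exact: semilattice_witness_maximal wtheta.
- by move=> theta'; apply: majority_witness_unique.
- exact: majority_witness_maximal wtheta.
Qed.
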